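(* Let $\mathcal C$ be a (strict) braided monoidal category in which idempotents split, $H$ a Hopf algebra in $\mathcal C$ with isomorphic antipode, $B$ a bialgebra in the category of right $H$-crossed modules and $C$ a bialgebra in the category of left $H$-crossed modules. Let $X=H\ltimes B$ and $Y=C\rtimes H$ be the corresponding bialgebras in the braided category of $H$-Hopf bimodules, and suppose that $$\Psi_{C,B}\circ\Psi_{B,C}=(\mu^B_r\otimes\mu^C_l)\circ(\mathrm{id}_B\otimes\Psi_{H,H}\otimes\mathrm{id}_C)\circ(\nu^B_r\otimes\nu^C_l)$$ (equivalently, that the mutual Hopf bimodule braiding of $X$ and $Y$ is involutive). Let $Z$ be the bialgebra in $\mathcal C$ obtained from the tensor product bialgebra $\underline Z=Y\otimes_HX=C\otimes H\otimes B$ in the category of $H$-Hopf bimodules. Then multiplication and comultiplication of $Z=C\otimes H\otimes B$ are $$\mathrm m_Z=(\mathrm m_C\otimes\mathrm{id}_H\otimes\mathrm m_B)(\mathrm{id}_C\otimes\mu_l^C\otimes\mathrm m_H\otimes\mu_r^B\otimes\mathrm{id}_B)(\mathrm{id}_C\otimes\mathrm{id}_H\otimes\Psi_{H,C}\otimes\Psi_{B,H}\otimes\mathrm{id}_H\otimes\mathrm{id}_B)(\mathrm{id}_C\otimes\Delta_H\otimes\Psi_{B,C}\otimes\Delta_H\otimes\mathrm{id}_B),$$ $$\Delta_Z=(\mathrm{id}_C\otimes\mathrm m_H\otimes\Psi_{C,B}\otimes\mathrm m_H\otimes\mathrm{id}_B)(\mathrm{id}_C\otimes\mathrm{id}_H\otimes\Psi_{C,H}\otimes\Psi_{H,B}\otimes\mathrm{id}_H\otimes\mathrm{id}_B)(\mathrm{id}_C\otimes\nu_l^C\otimes\Delta_H\otimes\nu_r^B\otimes\mathrm{id}_B)(\Delta_C\otimes\mathrm{id}_H\otimes\Delta_B),$$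 and the unit and counit are $\eta_Z=\eta_C\otimes\eta_H\otimes\eta_B$, $\varepsilon_Z=\varepsilon_C\otimes\varepsilon_H\otimes\varepsilon_B$. There are bialgebra monomorphisms $\mathrm{id}_{C\otimes H}\otimes\eta_B:C\rtimes H\to Z$ and $\eta_C\otimes\mathrm{id}_{H\otimes B}:H\ltimes B\to Z$, and bialgebra epimorphisms $\mathrm{id}_{C\otimes H}\otimes\varepsilon_B:Z\to C\rtimes H$ and $\varepsilon_C\otimes\mathrm{id}_{H\otimes B}:Z\to H\ltimes B$. Additionally $\mathrm{id}_C\otimes\eta_H\otimes\mathrm{id}_B:C\otimes B\to Z$ is an algebra monomorphism and $\mathrm{id}_C\otimes\varepsilon_H\otimes\mathrm{id}_B:Z\to C\otimes B$ is a coalgebra epimorphism.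
   Context: Notation: $\Psi$ is the braiding of $\mathcal C$; juxtaposition is composition; algebras/coalgebras/bialgebras in braided categories are the usual ones. $C\otimes B$ has the algebra structure with product $(\mathrm m_C\otimes\mathrm m_B)(\mathrm{id}\otimes\Psi_{B,C}\otimes\mathrm{id})$ and the coalgebra structure with coproduct $(\mathrm{id}\otimes\Psi_{C,B}\otimes\mathrm{id})(\Delta_C\otimes\Delta_B)$. Crossed modules. A right $H$-crossed module is an object $M$ with right $H$-action $\mu_r$ and right $H$-coaction $\nu_r$ such that $(\mu_r\otimes\mathrm m_H)(\mathrm{id}_M\otimes\Psi_{H,H}\otimes\mathrm{id}_H)(\nu_r\otimes\Delta_H)=(\mathrm{id}_M\otimes\mathrm m_H)(\Psi_{H,M}\otimes\mathrm{id}_H)(\mathrm{id}_H\otimes\nu_r\mu_r)(\Psi_{M,H}\otimes\mathrm{id}_H)(\mathrm{id}_M\otimes\Delta_H)$; these form a monoidal category with diagonal (co)actions, braided by $(\mathrm{id}_N\otimes\mu_r^M)(\Psi_{M,N}\otimes\mathrm{id}_H)(\mathrm{id}_M\otimes\nu_r^N):M\otimes N\to N\otimes M$. Left $H$-crossed modules are the mirror notion, braided by $(\mu_l^N\otimes\mathrm{id}_M)(\mathrm{id}_H\otimes\Psi_{M,N})(\nu_l^M\otimes\mathrm{id}_N)$. Hopf bimodules. An $H$-Hopf bimodule is an $H$-bimodule and $H$-bicomodule $X$ whose actions are bicomodule morphisms for the diagonal coactions on $H\otimes X$, $X\otimes H$. Morphisms are bimodule-bicomodule morphisms. The tensor product $X\otimes_HY$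 is the tensor product over $H$ of the underlying modules, with canonical projection $\lambda^H_{X,Y}:X\otimes Y\to X\otimes_HY$, and simultaneously the cotensor product over $H$, with canonical injection $\rho^H_{X,Y}:X\otimes_HY\to X\otimes Y$, where $\rho^H_{X,Y}\lambda^H_{X,Y}=(\mu_r^X\otimes\mu_l^Y)(\mathrm{id}_X\otimes\Psi_{H,H}\otimes\mathrm{id}_Y)(\nu_r^X\otimes\nu_l^Y)$; the unit object is $H$. The braiding ${}^{H}\Psi_{X,Y}:X\otimes_HY\to Y\otimes_HX$ is determined by $\rho^H_{Y,X}\,{}^H\Psi_{X,Y}\,\lambda^H_{X,Y}=(\mu_l^Y\otimes\mu_r^X)(\mathrm{id}_H\otimes\Psi_{X,Y}\otimes\mathrm{id}_H)(\nu_l^X\otimes\nu_r^Y)$. $X=H\ltimes B$ is $H\otimes B$ with left action $\mathrm m_H\otimes\mathrm{id}_B$, left coaction $\Delta_H\otimes\mathrm{id}_B$, and diagonal right action and coaction. $Y=C\rtimes H$ is $C\otimes H$ with right action $\mathrm{id}_C\otimes\mathrm m_H$, right coaction $\mathrm{id}_C\otimes\Delta_H$, and diagonal left action and coaction. As bialgebras in $\mathcal C$ (biproducts), $H\ltimes B$ has $\mathrm m_{H\ltimes B}=(\mathrm m_H\otimes\mathrm m_B)\big(\mathrm{id}_H\otimes(\mathrm{id}_H\otimes\mu_r)(\Psi_{B,H}\otimes\mathrm{id}_H)(\mathrm{id}_B\otimes\Delta_H)\otimes\mathrm{id}_B\big)$, $\Delta_{H\ltimes B}=\big(\mathrm{id}_H\otimes(\mathrm{id}_B\otimes\mathrm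 m_H)(\Psi_{H,B}\otimes\mathrm{id}_H)(\mathrm{id}_H\otimes\nu_r)\otimes\mathrm{id}_B\big)(\Delta_H\otimes\Delta_B)$, unit $\eta_H\otimes\eta_B$, counit $\varepsilon_H\otimes\varepsilon_B$; and $C\rtimes H$ has $\mathrm m_{C\rtimes H}=(\mathrm m_C\otimes\mathrm m_H)\big(\mathrm{id}_C\otimes(\mu_l\otimes\mathrm{id}_H)(\mathrm{id}_H\otimes\Psi_{H,C})(\Delta_H\otimes\mathrm{id}_C)\otimes\mathrm{id}_H\big)$, $\Delta_{C\rtimes H}=\big(\mathrm{id}_C\otimes(\mathrm m_H\otimes\mathrm{id}_C)(\mathrm{id}_H\otimes\Psi_{C,H})(\nu_l\otimes\mathrm{id}_H)\otimes\mathrm{id}_H\big)(\Delta_C\otimes\Delta_H)$, unit $\eta_C\otimes\eta_H$, counit $\varepsilon_C\otimes\varepsilon_H$. The bialgebra structure of $X$ in Hopf bimodules is determined by $\underline{\mathrm m}_X\lambda^H_{X,X}=\mathrm m_{H\ltimes B}$, $\rho^H_{X,X}\underline\Delta_X=\Delta_{H\ltimes B}$, $\underline\eta_X=\mathrm{id}_H\otimes\eta_B$, $\underline\varepsilon_X=\mathrm{id}_H\otimes\varepsilon_B$, and analogously for $Y$. $\underline Z=Y\otimes_HX$ is the tensor product bialgebra in Hopf bimodules with $\mathrm m_{\underline Z}=(\underline{\mathrm m}_Y\otimes_H\underline{\mathrm m}_X)(\mathrm{id}_Y\otimes_H{}^H\Psi_{X,Y}\otimes_H\mathrm{id}_X)$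 and $\Delta_{\underline Z}=(\mathrm{id}_Y\otimes_H{}^H\Psi_{Y,X}\otimes_H\mathrm{id}_X)(\underline\Delta_Y\otimes_H\underline\Delta_X)$. It is identified with $C\otimes H\otimes B$ via $\lambda^H_{Y,X}=\mathrm{id}_C\otimes\mathrm m_H\otimes\mathrm{id}_B$, $\rho^H_{Y,X}=\mathrm{id}_C\otimes\Delta_H\otimes\mathrm{id}_B$. A bialgebra $\underline Z$ in Hopf bimodules becomes a bialgebra $Z$ in $\mathcal C$ via $\mathrm m_Z=\mathrm m_{\underline Z}\lambda^H_{\underline Z,\underline Z}$, $\eta_Z=\eta_{\underline Z}\eta_H$, $\Delta_Z=\rho^H_{\underline Z,\underline Z}\Delta_{\underline Z}$, $\varepsilon_Z=\varepsilon_H\varepsilon_{\underline Z}$. *)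

(* Defs.v *)
From mathcomp Require Import ssreflect ssrfun ssrbool.
From Stdlib Require Import ClassicalEpsilon.

Set Implicit Arguments.
Unset Strict Implicit.
Unset Printing Implicit Defensive.

Declare Scope mor_scope.
Delimit Scope mor_scope with mor.
Local Open Scope mor_scope.

(* Strictness is an equality of objects, (a ⊠ b) ⊠ c = a ⊠ (b ⊠ c), which is
   not a conversion.  With a type family [Hom a b] every formula would need
   transports, so we use the presentation of a category by one collection of
   arrows with a domain and a codomain.  Composition is a total function whose
   value is unspecified when [dom f <> cod g]; the axioms only speak of
   composable pairs. *)
Record sbmc := SBMC {
  obj : Type;
  mor : Type;
  dom : mor -> obj;
  cod : mor -> obj;
  idm : obj -> mor;
  comp : mor -> mor -> mor;
  tob : obj -> obj -> obj;
  tun : obj;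
  tmor : mor -> mor -> mor;
  Psi : obj -> obj -> mor;
  dom_idm : forall a, dom (idm a) = a;
  cod_idm : forall a, cod (idm a) = a;
  dom_comp : forall f g, dom f = cod g -> dom (comp f g) = dom g;
  cod_comp : forall f g, dom f = cod g -> cod (comp f g) = cod f;
  compA : forall f g h, dom f = cod g -> dom g = cod h ->
    comp f (comp g h) = comp (comp f g) h;
  comp_idl : forall f, comp (idm (cod f)) f = f;
  comp_idr : forall f, comp f (idm (dom f)) = f;
  tobA : forall a b c, tob a (tob b c) = tob (tob a b) c;
  tob1l : forall a, tob tun a = a;
  tob1r : forall a, tob a tun = a;
  dom_tmor : forall f g, dom (tmor f g) = tob (dom f) (dom g);
  cod_tmor : forall f g, cod (tmor f g) = tob (cod f) (cod g);
  tmor_idm : forall a b, tmor (idm a) (idm b) = idm (tob a b);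
  tmor_comp : forall f g f' g', dom f = cod g -> dom f' = cod g' ->
    tmor (comp f g) (comp f' g') = comp (tmor f f') (tmor g g');
  tmorA : forall f g h, tmor f (tmor g h) = tmor (tmor f g) h;
  tmor1l : forall f, tmor (idm tun) f = f;
  tmor1r : forall f, tmor f (idm tun) = f;
  dom_Psi : forall a b, dom (Psi a b) = tob a b;
  cod_Psi : forall a b, cod (Psi a b) = tob b a;
  Psi_inv : forall a b, exists g,
    [/\ dom g = tob b a, cod g = tob a b,
        comp g (Psi a b) = idm (tob a b) & comp (Psi a b) g = idm (tob b a)];
  Psi_nat : forall f g,
    comp (Psi (cod f) (cod g)) (tmor f g) = comp (tmor g f) (Psi (dom f) (dom g));
  Psi_tobr : forall a b c,
    Psi a (tob b c) = comp (tmor (idm b) (Psi a c)) (tmor (Psi a b) (idm c));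
  Psi_tobl : forall a b c,
    Psi (tob a b) c = comp (tmor (Psi a c) (idm b)) (tmor (idm a) (Psi b c))
}.

Arguments idm {s}. Arguments Psi {s}. Arguments tun {s}.

Notation "a ⊠ b" := (tob a b) (at level 38, left associativity) : mor_scope.
Notation "f ⊗ g" := (tmor f g) (at level 38, left associativity) : mor_scope.
Notation "f ∘ g" := (comp f g) (at level 39, left associativity) : mor_scope.
Notation "f ::: a ~> b" := (dom f = a /\ cod f = b)
  (at level 70, a at level 68, b at level 68) : mor_scope.

Section Category.
Variable K : sbmc.
Implicit Types (a b : obj K) (f g h : mor K).

Definition iso f := exists g,
  [/\ g ::: cod f ~> dom f, g ∘ f = idm (dom f) & f ∘ g = idm (cod f)].

Definition mono f := forall g h,
  dom f = cod g -> dom f = cod h -> dom g = dom h -> f ∘ g = f ∘ h -> g = h.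

Definition epi f := forall g h,
  dom g = cod f -> dom h = cod f -> cod g = cod h -> g ∘ f = h ∘ f -> g = h.

Definition idempotents_split := forall e : mor K, dom e = cod e -> e ∘ e = e ->
  exists v p i, [/\ p ::: dom e ~> v, i ::: v ~> dom e, p ∘ i = idm v & i ∘ p = e].

Definition is_coequalizer f g q :=
  [/\ dom q = cod f, q ∘ f = q ∘ g &
      forall h, dom h = cod f -> h ∘ f = h ∘ g ->
      exists! k, k ::: cod q ~> cod h /\ k ∘ q = h].

Definition is_equalizer f g j :=
  [/\ cod j = dom f, f ∘ j = g ∘ j &
      forall h, cod h = dom f -> f ∘ h = g ∘ h ->
      exists! k, k ::: dom h ~> dom j /\ j ∘ k = h].

(* The morphism determined by [P] (used only when exactly one exists). *)
Definition the (P : mor K -> Prop) : mor K := epsilon (inhabits (idm tun)) P.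

End Category.

(* Raw data; also used for an object that is an algebra and a coalgebra
   without being a bialgebra. *)
Record bialg_data (K : sbmc) := BialgData {
  car :> obj K;
  mul : mor K;
  eta : mor K;
  Delta : mor K;
  eps : mor K
}.

Section Bialgebras.
Variable K : sbmc.
Implicit Types (A E : bialg_data K) (f psi S : mor K).

Definition algebra A :=
  [/\ mul A ::: A ⊠ A ~> A, eta A ::: tun ~> A,
      mul A ∘ (mul A ⊗ idm A) = mul A ∘ (idm A ⊗ mul A),
      mul A ∘ (eta A ⊗ idm A) = idm A & mul A ∘ (idm A ⊗ eta A) = idm A].

Definition coalgebra A :=
  [/\ Delta A ::: A ~> A ⊠ A, eps A ::: A ~> tun,
      (Delta A ⊗ idm A) ∘ Delta A = (idm A ⊗ Delta A) ∘ Delta A,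
      (eps A ⊗ idm A) ∘ Delta A = idm A & (idm A ⊗ eps A) ∘ Delta A = idm A].

(* Bialgebra with respect to a given braiding [psi] of A with itself. *)
Definition bialgebra_for psi A :=
  [/\ algebra A, coalgebra A,
      Delta A ∘ mul A
        = (mul A ⊗ mul A) ∘ (idm A ⊗ psi ⊗ idm A) ∘ (Delta A ⊗ Delta A),
      Delta A ∘ eta A = eta A ⊗ eta A &
      eps A ∘ mul A = eps A ⊗ eps A /\ eps A ∘ eta A = idm tun].

Definition bialgebra A := bialgebra_for (Psi A A) A.

Definition hopf_algebra A S :=
  [/\ bialgebra A, S ::: A ~> A,
      mul A ∘ (S ⊗ idm A) ∘ Delta A = eta A ∘ eps A &
      mul A ∘ (idm A ⊗ S) ∘ Delta A = eta A ∘ eps A].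

Definition algebra_morphism A E f :=
  [/\ f ::: A ~> E, f ∘ mul A = mul E ∘ (f ⊗ f) & f ∘ eta A = eta E].

Definition coalgebra_morphism A E f :=
  [/\ f ::: A ~> E, Delta E ∘ f = (f ⊗ f) ∘ Delta A & eps E ∘ f = eps A].

Definition bialgebra_morphism A E f :=
  algebra_morphism A E f /\ coalgebra_morphism A E f.

Definition tens_algcoalg A E : bialg_data K := BialgData
  (A ⊠ E)
  ((mul A ⊗ mul E) ∘ (idm A ⊗ Psi E A ⊗ idm E))
  (eta A ⊗ eta E)
  ((idm A ⊗ Psi A E ⊗ idm E) ∘ (Delta A ⊗ Delta E))
  (eps A ⊗ eps E).

End Bialgebras.

Section Modules.
Variables (K : sbmc) (H : bialg_data K).
Implicit Types (M N : obj K) (f am an cm cn : mor K).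

Definition rmodule M am :=
  [/\ am ::: M ⊠ H ~> M, am ∘ (am ⊗ idm H) = am ∘ (idm M ⊗ mul H)
    & am ∘ (idm M ⊗ eta H) = idm M].

Definition lmodule M am :=
  [/\ am ::: H ⊠ M ~> M, am ∘ (idm H ⊗ am) = am ∘ (mul H ⊗ idm M)
    & am ∘ (eta H ⊗ idm M) = idm M].

Definition rcomodule M cm :=
  [/\ cm ::: M ~> M ⊠ H, (cm ⊗ idm H) ∘ cm = (idm M ⊗ Delta H) ∘ cm
    & (idm M ⊗ eps H) ∘ cm = idm M].

Definition lcomodule M cm :=
  [/\ cm ::: M ~> H ⊠ M, (idm H ⊗ cm) ∘ cm = (Delta H ⊗ idm M) ∘ cm
    & (eps H ⊗ idm M) ∘ cm = idm M].

Definition rmod_mor am an f := f ∘ am = an ∘ (f ⊗ idm H).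
Definition lmod_mor am an f := f ∘ am = an ∘ (idm H ⊗ f).
Definition rcom_mor cm cn f := cn ∘ f = (f ⊗ idm H) ∘ cm.
Definition lcom_mor cm cn f := cn ∘ f = (idm H ⊗ f) ∘ cm.

Definition ract_tens M N am an :=
  (am ⊗ an) ∘ (idm M ⊗ Psi N H ⊗ idm H) ∘ (idm M ⊗ idm N ⊗ Delta H).
Definition lact_tens M N am an :=
  (am ⊗ an) ∘ (idm H ⊗ Psi H M ⊗ idm N) ∘ (Delta H ⊗ idm M ⊗ idm N).
Definition rcoact_tens M N cm cn :=
  (idm M ⊗ idm N ⊗ mul H) ∘ (idm M ⊗ Psi H N ⊗ idm H) ∘ (cm ⊗ cn).
Definition lcoact_tens M N cm cn :=
  (mul H ⊗ idm M ⊗ idm N) ∘ (idm H ⊗ Psi M H ⊗ idm N) ∘ (cm ⊗ cn).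

Definition rcrossed M am cm :=
  [/\ rmodule M am, rcomodule M cm &
      (am ⊗ mul H) ∘ (idm M ⊗ Psi H H ⊗ idm H) ∘ (cm ⊗ Delta H)
      = (idm M ⊗ mul H) ∘ (Psi H M ⊗ idm H) ∘ (idm H ⊗ (cm ∘ am))
          ∘ (Psi M H ⊗ idm H) ∘ (idm M ⊗ Delta H)].

Definition lcrossed M am cm :=
  [/\ lmodule M am, lcomodule M cm &
      (mul H ⊗ am) ∘ (idm H ⊗ Psi H H ⊗ idm M) ∘ (Delta H ⊗ cm)
      = (mul H ⊗ idm M) ∘ (idm H ⊗ Psi M H) ∘ ((cm ∘ am) ⊗ idm H)
          ∘ (idm H ⊗ Psi H M) ∘ (Delta H ⊗ idm M)].

End Modules.

(* Bialgebra data together with an H-action and an H-coaction (on the right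
   for B, on the left for C). *)
Record xbialg_data (K : sbmc) := XBialgData {
  xalg :> bialg_data K;
  act : mor K;
  coact : mor K
}.

Section CrossedBialgebras.
Variables (K : sbmc) (H : bialg_data K).
Implicit Types (B C : xbialg_data K).

(* The four structure maps are morphisms of crossed modules, the tensor square
   carrying the diagonal structure and the unit object the trivial one. *)
Definition right_crossed_bialgebra B :=
  [/\ rcrossed H B (act B) (coact B),
      [/\ rmod_mor H (ract_tens H B B (act B) (act B)) (act B) (mul B),
          rmod_mor H (eps H) (act B) (eta B),
          rmod_mor H (act B) (ract_tens H B B (act B) (act B)) (Delta B) &
          rmod_mor H (act B) (eps H) (eps B)],
      [/\ rcom_mor H (rcoact_tens H B B (coact B) (coact B)) (coact B) (mul B),
          rcom_mor H (eta H) (coact B) (eta B),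
          rcom_mor H (coact B) (rcoact_tens H B B (coact B) (coact B)) (Delta B) &
          rcom_mor H (coact B) (eta H) (eps B)] &
      bialgebra_for
        ((idm B ⊗ act B) ∘ (Psi B B ⊗ idm H) ∘ (idm B ⊗ coact B)) B].

Definition left_crossed_bialgebra C :=
  [/\ lcrossed H C (act C) (coact C),
      [/\ lmod_mor H (lact_tens H C C (act C) (act C)) (act C) (mul C),
          lmod_mor H (eps H) (act C) (eta C),
          lmod_mor H (act C) (lact_tens H C C (act C) (act C)) (Delta C) &
          lmod_mor H (act C) (eps H) (eps C)],
      [/\ lcom_mor H (lcoact_tens H C C (coact C) (coact C)) (coact C) (mul C),
          lcom_mor H (eta H) (coact C) (eta C),
          lcom_mor H (coact C) (lcoact_tens H C C (coact C) (coact C)) (Delta C) &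
          lcom_mor H (coact C) (eta H) (eps C)] &
      bialgebra_for
        ((act C ⊗ idm C) ∘ (idm H ⊗ Psi C C) ∘ (coact C ⊗ idm C)) C].

Definition ltimes B : bialg_data K := BialgData
  (H ⊠ B)
  ((mul H ⊗ mul B)
     ∘ (idm H ⊗ ((idm H ⊗ act B) ∘ (Psi B H ⊗ idm H) ∘ (idm B ⊗ Delta H)) ⊗ idm B))
  (eta H ⊗ eta B)
  ((idm H ⊗ ((idm B ⊗ mul H) ∘ (Psi H B ⊗ idm H) ∘ (idm H ⊗ coact B)) ⊗ idm B)
     ∘ (Delta H ⊗ Delta B))
  (eps H ⊗ eps B).

Definition rtimes C : bialg_data K := BialgData
  (C ⊠ H)
  ((mul C ⊗ mul H)
     ∘ (idm C ⊗ ((act C ⊗ idm H) ∘ (idm H ⊗ Psi H C) ∘ (Delta H ⊗ idm C)) ⊗ idm H))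
  (eta C ⊗ eta H)
  ((idm C ⊗ ((mul H ⊗ idm C) ∘ (idm H ⊗ Psi C H) ∘ (coact C ⊗ idm H)) ⊗ idm H)
     ∘ (Delta C ⊗ Delta H))
  (eps C ⊗ eps H).

End CrossedBialgebras.

Record hbim_data (K : sbmc) := HbimData {
  hcar :> obj K;
  lact : mor K;
  ract : mor K;
  lcoact : mor K;
  rcoact : mor K
}.

Section HopfBimodules.
Variables (K : sbmc) (H : bialg_data K).
Implicit Types (X Y Z : hbim_data K).

Definition hopf_bimodule X :=
  [/\ [/\ lmodule H X (lact X), rmodule H X (ract X) &
          ract X ∘ (lact X ⊗ idm H) = lact X ∘ (idm H ⊗ ract X)],
      [/\ lcomodule H X (lcoact X), rcomodule H X (rcoact X) &
          (lcoact X ⊗ idm H) ∘ rcoact X = (idm H ⊗ rcoact X) ∘ lcoact X],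
      lcom_mor H (lcoact_tens H H X (Delta H) (lcoact X)) (lcoact X) (lact X)
        /\ rcom_mor H (rcoact_tens H H X (Delta H) (rcoact X)) (rcoact X) (lact X) &
      lcom_mor H (lcoact_tens H X H (lcoact X) (Delta H)) (lcoact X) (ract X)
        /\ rcom_mor H (rcoact_tens H X H (rcoact X) (Delta H)) (rcoact X) (ract X)].

Definition hbim_unit : hbim_data K :=
  HbimData H (mul H) (mul H) (Delta H) (Delta H).

(* A choice, for all Hopf bimodules X and Y, of their tensor product over H
   (coequalizer [lam]), which is at the same time their cotensor product
   (equalizer [rho]). *)
Record rel_tensor := RelTensor {
  ht : hbim_data K -> hbim_data K -> hbim_data K;
  lam : hbim_data K -> hbim_data K -> mor K;
  rho : hbim_data K -> hbim_data K -> mor K;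
  ht_hopf : forall X Y, hopf_bimodule X -> hopf_bimodule Y ->
    hopf_bimodule (ht X Y);
  lam_typ : forall X Y, hopf_bimodule X -> hopf_bimodule Y ->
    lam X Y ::: X ⊠ Y ~> ht X Y;
  rho_typ : forall X Y, hopf_bimodule X -> hopf_bimodule Y ->
    rho X Y ::: ht X Y ~> X ⊠ Y;
  lam_coeq : forall X Y, hopf_bimodule X -> hopf_bimodule Y ->
    is_coequalizer (ract X ⊗ idm Y) (idm X ⊗ lact Y) (lam X Y);
  rho_eq : forall X Y, hopf_bimodule X -> hopf_bimodule Y ->
    is_equalizer (rcoact X ⊗ idm Y) (idm X ⊗ lcoact Y) (rho X Y);
  lam_bimod : forall X Y, hopf_bimodule X -> hopf_bimodule Y ->
    lmod_mor H (lact X ⊗ idm Y) (lact (ht X Y)) (lam X Y)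
    /\ rmod_mor H (idm X ⊗ ract Y) (ract (ht X Y)) (lam X Y);
  rho_bicom : forall X Y, hopf_bimodule X -> hopf_bimodule Y ->
    lcom_mor H (lcoact (ht X Y)) (lcoact X ⊗ idm Y) (rho X Y)
    /\ rcom_mor H (rcoact (ht X Y)) (idm X ⊗ rcoact Y) (rho X Y);
  rho_lam : forall X Y, hopf_bimodule X -> hopf_bimodule Y ->
    rho X Y ∘ lam X Y
    = (ract X ⊗ lact Y) ∘ (idm X ⊗ Psi H H ⊗ idm Y) ∘ (rcoact X ⊗ lcoact Y)
}.

Definition hbim_ltimes (B : xbialg_data K) : hbim_data K := HbimData
  (H ⊠ B)
  (mul H ⊗ idm B) (ract_tens H H B (mul H) (act B))
  (Delta H ⊗ idm B) (rcoact_tens H H B (Delta H) (coact B)).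

Definition hbim_rtimes (C : xbialg_data K) : hbim_data K := HbimData
  (C ⊠ H)
  (lact_tens H C H (act C) (mul H)) (idm C ⊗ mul H)
  (lcoact_tens H C H (coact C) (Delta H)) (idm C ⊗ Delta H).

Section Monoidal.
Variable T : rel_tensor.
Local Notation "X ⊗H Y" := (ht T X Y) (at level 38, left associativity).

Definition hmap X Y X' Y' (f g : mor K) : mor K := the (fun h =>
  h ::: X ⊗H Y ~> X' ⊗H Y' /\ h ∘ lam T X Y = lam T X' Y' ∘ (f ⊗ g)).

Definition hassoc X Y Z : mor K := the (fun h =>
  h ::: (X ⊗H Y) ⊗H Z ~> X ⊗H (Y ⊗H Z) /\
  h ∘ lam T (X ⊗H Y) Z ∘ (lam T X Y ⊗ idm Z)
    = lam T X (Y ⊗H Z) ∘ (idm X ⊗ lam T Y Z)).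

Definition hassocV X Y Z : mor K := the (fun h =>
  h ::: X ⊗H (Y ⊗H Z) ~> (X ⊗H Y) ⊗H Z /\
  h ∘ lam T X (Y ⊗H Z) ∘ (idm X ⊗ lam T Y Z)
    = lam T (X ⊗H Y) Z ∘ (lam T X Y ⊗ idm Z)).

(* The unit isomorphism H ⊗_H H -> H and its inverse. *)
Definition hunit : mor K := the (fun h =>
  h ::: hbim_unit ⊗H hbim_unit ~> H /\ h ∘ lam T hbim_unit hbim_unit = mul H).
Definition hunitV : mor K := the (fun h =>
  h ::: H ~> hbim_unit ⊗H hbim_unit /\ rho T hbim_unit hbim_unit ∘ h = Delta H).

Definition hbraid X Y : mor K := the (fun h =>
  h ::: X ⊗H Y ~> Y ⊗H X /\
  rho T Y X ∘ h ∘ lam T X Y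
    = (lact Y ⊗ ract X) ∘ (idm H ⊗ Psi X Y ⊗ idm H) ∘ (lcoact X ⊗ rcoact Y)).

(* For f : P ⊗_H Q -> P' ⊗_H Q', the morphism id ⊗_H f ⊗_H id from
   (A ⊗_H P) ⊗_H (Q ⊗_H D) to (A ⊗_H P') ⊗_H (Q' ⊗_H D). *)
Definition hmiddle A P Q P' Q' D (f : mor K) : mor K :=
  hassocV A P' (Q' ⊗H D)
  ∘ hmap A (P ⊗H (Q ⊗H D)) A (P' ⊗H (Q' ⊗H D)) (idm A)
      (hassoc P' Q' D ∘ hmap (P ⊗H Q) D (P' ⊗H Q') D f (idm D) ∘ hassocV P Q D)
  ∘ hassoc A P (Q ⊗H D).

Record hbialg_data := HbialgData {
  hbim :> hbim_data K;
  hmul : mor K;    (* hbim ⊗H hbim ~> hbim *)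
  heta : mor K;    (* H ~> hbim *)
  hDelta : mor K;  (* hbim ~> hbim ⊗H hbim *)
  heps : mor K     (* hbim ~> H *)
}.

Definition hb_ltimes (B : xbialg_data K) : hbialg_data :=
  let X := hbim_ltimes B in HbialgData X
    (the (fun h => h ::: X ⊗H X ~> X /\ h ∘ lam T X X = mul (ltimes H B)))
    (idm H ⊗ eta B)
    (the (fun h => h ::: X ~> X ⊗H X /\ rho T X X ∘ h = Delta (ltimes H B)))
    (idm H ⊗ eps B).

Definition hb_rtimes (C : xbialg_data K) : hbialg_data :=
  let Y := hbim_rtimes C in HbialgData Y
    (the (fun h => h ::: Y ⊗H Y ~> Y /\ h ∘ lam T Y Y = mul (rtimes H C)))
    (eta C ⊗ idm H)
    (the (fun h => h ::: Y ~> Y ⊗H Y /\ rho T Y Y ∘ h = Delta (rtimes H C)))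
    (eps C ⊗ idm H).

Definition hb_tensor (A D : hbialg_data) : hbialg_data := HbialgData
  (A ⊗H D)
  (hmap (A ⊗H A) (D ⊗H D) A D (hmul A) (hmul D)
     ∘ hmiddle A D A A D D (hbraid D A))
  (hmap hbim_unit hbim_unit A D (heta A) (heta D) ∘ hunitV)
  (hmiddle A A D D A D (hbraid A D)
     ∘ hmap A D (A ⊗H A) (D ⊗H D) (hDelta A) (hDelta D))
  (hunit ∘ hmap A D hbim_unit hbim_unit (heps A) (heps D)).

Definition hb_forget (A : hbialg_data) : bialg_data K := BialgData
  A
  (hmul A ∘ lam T A A)
  (heta A ∘ eta H)
  (rho T A A ∘ hDelta A)
  (eps H ∘ heps A).

End Monoidal.
End HopfBimodules.

(* Main.v *)
From mathcomp Require Import ssreflect ssrfun ssrbool eqtype ssrnat seq.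
From Stdlib Require Import ClassicalEpsilon.
Require Import Defs.

(** For Hopf bimodules the projection X ⊠ Y -> X ⊗_H Y is a split epimorphism:
    x ⊗ y |-> x_0 S(x_1) ⊗ x_2 y is balanced and is absorbed by every balanced
    morphism.  Dually X ⊗_H Y -> X ⊠ Y is a split monomorphism.  Hence all the
    morphisms characterised through [lam] exist and also satisfy the
    corresponding equations for [rho], and the structure of Z is read off by
    lifting to Y ⊠ X ⊠ Y ⊠ X.

    As X is free and cofree over H on the left, and Y on the right, a bimodule
    and bicomodule endomorphism of X ⊗_H Y is determined by the morphism
    B ⊠ C -> B ⊠ C it induces; for the square of the braiding this is
    Psi C B ∘ Psi B C.

    Z is generated as an algebra by C, H and B, so the multiplicativity of its
    coproduct reduces to pairs of generators.  The pair (B, C) is the hypothesis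
    on the braidings, (H, C) and (B, H) are the crossed module axioms, (C, C) and
    (B, B) the bialgebra axioms of C and B. *)

(** Since strictness is an equality of objects, typing a composite already means rewriting objects.
    Equalities are therefore checked on words of atomic strands, where the associativity and unit
    laws of the tensor product hold by computation.

    The splittings of [lam] and [rho] matter because tensoring with an object is not assumed to
    preserve coequalizers or equalizers. A split one survives any tensoring, so morphisms on
    iterated tensor products over H can be defined and compared on plain tensor products. The
    antipode enters through these splittings.

    The bialgebra axioms of [Z] are checked on the explicit formulas rather than inside the category
    of Hopf bimodules, whose coherence and whose bialgebras X and Y would otherwise have to be
    treated first. The biproducts C ⋊ H and H ⋉ B are retracts of [Z] through bialgebra morphisms,
    and inherit their axioms from it. *)

Set Implicit Arguments.
Unset Strict Implicit.
Unset Printing Implicit Defensive.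

Local Open Scope mor_scope.

(** * Rewriting of string diagrams by reflection *)

(* Objects are named by numbers.  A diagram is a sequence of layers, read from
   the source to the target; the layer [(k, g)] applies [g], a box [inl n] or the
   braiding [inr (a, b)] of two atomic objects, to the strands that follow the
   first [k] ones. *)
Definition word := seq nat.

Inductive oexp := O1 | OA of nat | OT of oexp & oexp.

Fixpoint flat (o : oexp) : word :=
  match o with
  | O1 => [::]
  | OA n => [:: n]
  | OT a b => flat a ++ flat b
  end.

Definition gen := (nat + nat * nat)%type.
Definition layer := (nat * gen)%type.
Definition diag := seq layer.

Inductive expr :=
  | EI of oexp
  | EB of nat
  | EX of oexp & oexp
  | EC of expr & expr
  | ET of expr & expr.

Section Combinatorics.
Variable ty : seq (word * word).

Definition gin (g : gen) : word :=
  match g with inl n => (nth ([::], [::]) ty n).1 | inr (a, b) => [:: a; b] end.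
Definition gout (g : gen) : word :=
  match g with inl n => (nth ([::], [::]) ty n).2 | inr (a, b) => [:: b; a] end.

Definition shift (k : nat) (d : diag) : diag := [seq (k + x.1, x.2) | x <- d].

Definition lcod (w : word) (x : layer) : option word :=
  let r := drop x.1 w in
  if (x.1 <= size w) && (take (size (gin x.2)) r == gin x.2)
  then Some (take x.1 w ++ gout x.2 ++ drop (size (gin x.2)) r) else None.

Fixpoint target (w : word) (d : diag) : option word :=
  if d is x :: d' then obind (fun w' => target w' d') (lcod w x) else Some w.

(** Here [x] is applied before [y]; in the exchanged pair, the layer further right has its offset
    corrected by the change of width of the other. If an empty output of [x] meets an empty input of
    [y], both tests succeed and [y] is placed to the right of [x]. *)
Definition commute (x y : layer) : option (layer * layer) :=
  if x.1 + size (gout x.2) <= y.1 then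
    Some ((y.1 - size (gout x.2) + size (gin x.2), y.2), x)
  else if y.1 + size (gin y.2) <= x.1 then
    Some (y, (x.1 - size (gin y.2) + size (gout y.2), x.2))
  else None.

Fixpoint lift (b : diag) (x : layer) : option (layer * diag) :=
  if b is y :: b' then
    if lift b' x is Some (x', b'') then
      if commute y x' is Some (x'', y') then Some (x'', y' :: b'') else None
    else None
  else Some (x, [::]).

(** Collects the results of deleting from [pre ++ d] a layer that can be moved to the front and
    becomes [x] there. All candidates are kept because the same box may occur several times;
    [isotopic] backtracks over them. *)
Fixpoint extract (x : layer) (pre d : diag) : seq diag :=
  if d is y :: d' then
    let others := extract x (rcons pre y) d' in
    if y.2 == x.2 then
      if lift pre y is Some (y', pre') then
        if y'.1 == x.1 then (pre' ++ d') :: others else others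
      else others
    else others
  else [::].

(* Equality up to the interchange law. *)
Fixpoint isotopic (d e : diag) : bool :=
  if d is x :: d' then has (isotopic d') (extract x [::] e) else nilp e.

(** The hexagon axioms cut the braiding of two words into crossings of single strands, the only
    braidings that occur in layers. *)
Fixpoint braid1 (i a : nat) (v : word) : diag :=
  if v is b :: v' then (i, inr (a, b)) :: braid1 i.+1 a v' else [::].
Fixpoint braid (u v : word) : diag :=
  if u is a :: u' then shift 1 (braid u' v) ++ braid1 0 a v else [::].

Fixpoint compile (e : expr) : option (word * diag * word) :=
  match e with
  | EI o => Some (flat o, [::], flat o)
  | EB n => let g := inl n in Some (gin g, [:: (0, g)], gout g)
  | EX a b => Some (flat a ++ flat b, braid (flat a) (flat b), flat b ++ flat a)
  | EC f g =>
      if compile g is Some (u, dg, v) then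
        if compile f is Some (v', df, w) then
          if v == v' then Some (u, dg ++ df, w) else None
        else None
      else None
  | ET f g =>
      if compile f is Some (u, df, v) then
        if compile g is Some (u', dg, v') then
          Some (u ++ u', df ++ shift (size v) dg, v ++ v')
        else None
      else None
  end.

Definition rule := (word * diag * diag)%type.

(** A rule that does not compile, or whose sides have different types, becomes the empty rule: this
    one is sound and keeps the numbering of the others. *)
Definition crule (r : expr * expr) : rule :=
  if compile r.1 is Some (u, d1, v) then
    if compile r.2 is Some (u', d2, v') then
      if (u == u') && (v == v') then (u, d1, d2) else ([::], [::], [::])
    else ([::], [::], [::])
  else ([::], [::], [::]).

(* Rewrite with [r] the segment of [d] at height [i] and offset [k]. *)
Definition rewr (w : word) (d : diag) (i k : nat) (r : rule) : option diag :=
  let: (u, d1, d2) := r in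
  let pre := take i d in
  let post := drop i d in
  if target w pre is Some w1 then
    if [&& k <= size w1, take (size u) (drop k w1) == u
         & take (size d1) post == shift k d1]
    then Some (pre ++ shift k d2 ++ drop (size d1) post) else None
  else None.

(** Rule number, height and offset, followed by a representative of the current diagram, up to
    interchange, in which the left-hand side is a contiguous segment. *)
Definition step := (nat * nat * nat * diag)%type.

Fixpoint exec (rs : seq rule) (w : word) (d : diag) (t : seq step) : option diag :=
  if t is (n, i, k, d') :: t' then
    if isotopic d' d then
      if rewr w d' i k (nth ([::], [::], [::]) rs n) is Some d'' then exec rs w d'' t'
      else None
    else None
  else Some d.

Definition check (rs : seq (expr * expr)) (e1 e2 : expr) (t1 t2 : seq step) : bool :=
  let crs := [seq crule r | r <- rs] in
  if compile e1 is Some (u, d1, v) then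
    if compile e2 is Some (u', d2, v') then
      if u == u' then
        if exec crs u d1 t1 is Some d1' then
          if exec crs u d2 t2 is Some d2' then isotopic d1' d2' else false
        else false
      else false
    else false
  else false.

(* The search for a derivation needs no justification: [check] replays it. *)

Fixpoint sink (x : layer) (t : diag) : option (diag * layer) :=
  if t is y :: t' then
    if commute x y is Some (y', x') then
      if sink x' t' is Some (t'', x'') then Some (y' :: t'', x'') else None
    else None
  else Some ([::], x).

Fixpoint sift (skipped t n : diag) : diag * diag :=
  if skipped is x :: s then
    if sink x t is Some (t', x') then sift s t' (x' :: n) else sift s (x :: t) n
  else (t, n).

Fixpoint lifts (b a : diag) : option (diag * diag) :=
  if a is x :: a' then
    if lift b x is Some (x', b') then
      if lifts b' a' is Some (a'', b'') then Some (x' :: a'', b'') else None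
    else None
  else Some ([::], b).

Definition last_layer (d : diag) : layer := last (0, inl 0) d.

(** Matches the remaining pattern layers [ps] behind the block [m] matched so far. Skipped layers on
    which a candidate depends must be movable in front of the block; the others go behind it.
    Offsets are compared relative to the first layer, [o1] being its offset in the pattern. *)
Fixpoint gather (o1 : nat) (m : diag) (ps : diag) (post : diag) {struct ps}
    : option (diag * diag * diag) :=
  if ps is p :: ps' then
    (fix cand (sk post : diag) {struct post} :=
       if post is y :: tl then
         if y.2 == p.2 then
           let: (t, n) := sift sk [:: y] [::] in
           let a := take (size t).-1 t in
           let y' := last_layer t in
           let res :=
             if lifts m a is Some (a', m') then
               if y'.1 + o1 == (head y' m').1 + p.1 then
                 if gather o1 (rcons m' y') ps' (n ++ tl) is Some (a2, m2, rest) then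
                   Some (a' ++ a2, m2, rest)
                 else None
               else None
             else None in
           if res is Some _ then res else cand (y :: sk) tl
         else cand (y :: sk) tl
       else None) [::] post
  else Some ([::], m, post).

Definition try_at (n : nat) (r : rule) (w : word) (pre : diag) (x : layer) (post : diag)
    : option (step * diag) :=
  let: (u, d1, d2) := r in
  if d1 is l1 :: d1' then
    if (x.2 == l1.2) && (l1.1 <= x.1) then
      if gather l1.1 [:: x] d1' post is Some (a, m, rest) then
        let k := (head x m).1 - l1.1 in
        let i := size pre + size a in
        let cand := pre ++ a ++ m ++ rest in
        if rewr w cand i k r is Some d' then Some ((n, i, k, cand), d') else None
      else None
    else None
  else None.

Fixpoint find_at (n : nat) (r : rule) (w : word) (pre d : diag) : option (step * diag) :=
  if d is x :: post then
    if try_at n r w pre x post is Some res then Some res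
    else find_at n r w (rcons pre x) post
  else None.

Fixpoint first_step (n : nat) (rs : seq rule) (w : word) (d : diag) : option (step * diag) :=
  if rs is r :: rs' then
    if find_at n r w [::] d is Some res then Some res else first_step n.+1 rs' w d
  else None.

Fixpoint normalize (fuel : nat) (rs : seq rule) (w : word) (d : diag) (acc : seq step)
    : seq step * diag :=
  if fuel is fuel'.+1 then
    if first_step 0 rs w d is Some (s, d') then normalize fuel' rs w d' (s :: acc)
    else (rev acc, d)
  else (rev acc, d).

Definition search (fuel : nat) (rs : seq (expr * expr)) (e : expr) : seq step * diag :=
  if compile e is Some (u, d, v) then normalize fuel [seq crule r | r <- rs] u d [::]
  else ([::], [::]).

Definition oword (w : word) : oexp := foldr (fun n o => OT (OA n) o) O1 w.

Definition egen (g : gen) : expr :=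
  match g with inl n => EB n | inr (a, b) => EX (OA a) (OA b) end.

(* The strand [c] starts on the left ([natL]) or on the right ([natR]) of [g]. *)
Definition natL (g : gen) (c : nat) : expr * expr :=
  (EC (EX (OA c) (oword (gout g))) (ET (EI (OA c)) (egen g)),
   EC (ET (egen g) (EI (OA c))) (EX (OA c) (oword (gin g)))).
Definition natR (g : gen) (c : nat) : expr * expr :=
  (EC (EX (oword (gout g)) (OA c)) (ET (egen g) (EI (OA c))),
   EC (ET (EI (OA c)) (egen g)) (EX (oword (gin g)) (OA c))).

(* Boxes with fewer outputs than inputs are moved after the braidings, the
   others before them. *)
Definition moves_later (g : gen) : bool :=
  let i := size (gin g) in let o := size (gout g) in
  if o == 0 then false else (i == 0) || (o < i).

Definition flip {A : Type} (b : bool) (r : A * A) : A * A := if b then r else (r.2, r.1).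

(** The orientation makes a box without inputs or without outputs absorb the crossings it meets,
    since braiding with the empty word is the empty diagram. The last block is naturality with
    respect to a crossing, that is, the Yang-Baxter relation. *)
Definition nat_rules (nobj : nat) : seq (expr * expr) :=
  let boxes := [seq inl n | n <- iota 0 (size ty)] : seq gen in
  let atoms := iota 0 nobj in
  flatten [seq flatten [seq [:: flip (moves_later g) (natL g c);
                                flip (moves_later g) (natR g c)] | c <- atoms] | g <- boxes]
  ++ flatten [seq flatten [seq [seq natL (inr (a, b)) c | c <- atoms] | a <- atoms] | b <- atoms].

End Combinatorics.

(** * Interpretation of diagrams as morphisms, and soundness of the checker *)

Section Semantics.
Variable K : sbmc.
Variables (os : seq (obj K)) (gs : seq (mor K)) (ty : seq (oexp * oexp)).

Definition ob (n : nat) : obj K := nth tun os n.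

Fixpoint oden (o : oexp) : obj K :=
  match o with O1 => tun | OA n => ob n | OT a b => oden a ⊠ oden b end.

Definition box (n : nat) : mor K := nth (idm tun) gs n.

Fixpoint den (e : expr) : mor K :=
  match e with
  | EI o => idm (oden o)
  | EB n => box n
  | EX a b => Psi (oden a) (oden b)
  | EC f g => den f ∘ den g
  | ET f g => den f ⊗ den g
  end.

Fixpoint typed (gs : seq (mor K)) (ty : seq (oexp * oexp)) : Prop :=
  match gs, ty with
  | g :: gs', t :: ty' => g ::: oden t.1 ~> oden t.2 /\ typed gs' ty'
  | [::], [::] => True
  | _, _ => False
  end.

Fixpoint holds (rs : seq (expr * expr)) : Prop :=
  if rs is r :: rs' then den r.1 = den r.2 /\ holds rs' else True.

Definition wty : seq (word * word) := [seq (flat t.1, flat t.2) | t <- ty].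

Hypothesis typed_gs : typed gs ty.

Definition wob (w : word) : obj K := foldr (fun n a => ob n ⊠ a) tun w.

Lemma wob_cat u v : wob (u ++ v) = wob u ⊠ wob v.
Proof. by elim: u => [|a u IH] /=; rewrite ?tob1l // IH tobA. Qed.

Lemma oden_flat o : oden o = wob (flat o).
Proof. by elim: o => [|n|a IHa b IHb] //=; rewrite ?tob1r // wob_cat IHa IHb. Qed.

Lemma flat_oword w : flat (oword w) = w.
Proof. by elim: w => //= a w ->. Qed.

Definition gmor (g : gen) : mor K :=
  match g with inl n => box n | inr (a, b) => Psi (ob a) (ob b) end.

Notation gin := (gin wty).
Notation gout := (gout wty).

Lemma gmor_typ g : gmor g ::: wob (gin g) ~> wob (gout g).
Proof.
case: g => [n|[a b]] /=; last by rewrite dom_Psi cod_Psi !tob1r.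
rewrite /box /wty.
elim: (gs) (ty) typed_gs n => [|g gs' IH] [|t ty'] //=.
  by move=> _ n; rewrite !nth_nil dom_idm cod_idm.
by move=> [[? ?] /IH T] [|n] //=; rewrite -!oden_flat.
Qed.

(** A relation rather than a function, because a layer has a meaning only where the current word
    splits around its inputs; [sem_det] recovers functionality. *)
Inductive sem : word -> diag -> word -> mor K -> Prop :=
  | sem_nil w : sem w [::] w (idm (wob w))
  | sem_cons l g r d v f : sem (l ++ gout g ++ r) d v f ->
      sem (l ++ gin g ++ r) ((size l, g) :: d) v
        (f ∘ (idm (wob l) ⊗ gmor g ⊗ idm (wob r))).

Lemma sem_typ w d v f : sem w d v f -> f ::: wob w ~> wob v.
Proof.
elim=> [w'|l g r d' v' f' _ [df cf]] /=; first by rewrite dom_idm cod_idm.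
have [dg cg] := gmor_typ g.
by rewrite dom_comp ?cod_comp ?cod_tmor ?dom_tmor ?cod_idm ?dom_idm ?dg ?cg ?df ?cf
     !wob_cat ?tobA.
Qed.

Lemma sem_inv w d v f : sem w d v f ->
  match d with
  | [::] => v = w /\ f = idm (wob w)
  | x :: d' => exists l r f', [/\ w = l ++ gin x.2 ++ r, size l = x.1,
      sem (l ++ gout x.2 ++ r) d' v f' &
      f = f' ∘ (idm (wob l) ⊗ gmor x.2 ⊗ idm (wob r))]
  end.
Proof. by case=> // l g r d' v' f' S; exists l, r, f'. Qed.

Lemma cat_inj_size (T : Type) (a a' b b' : seq T) :
  a ++ b = a' ++ b' -> size a = size a' -> a = a' /\ b = b'.
Proof.
elim: a a' => [|x a IH] [|y a'] //= [<- E] [s].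
by have [-> ->] := IH _ E s.
Qed.

Lemma sem_det w d v f v' f' : sem w d v f -> sem w d v' f' -> v = v' /\ f = f'.
Proof.
move=> S; elim: S v' f' => [w'|l g r d' v1 f1 S IH] v' f' /sem_inv //=.
  by case=> -> ->.
move=> [l' [r' [f2 [E s S2 ->]]]].
have [El E'] := cat_inj_size E (esym s).
have [_ Er] := cat_inj_size E' erefl.
by subst l' r'; have [-> ->] := IH _ _ S2.
Qed.

Lemma sem_cat w d1 v f1 d2 u f2 :
  sem w d1 v f1 -> sem v d2 u f2 -> sem w (d1 ++ d2) u (f2 ∘ f1).
Proof.
move=> S1; elim: S1 u f2 => [w'|l g r d v' f S IH] u f2 S2 /=.
  by have [<- _] := sem_typ S2; rewrite comp_idr.
have [df2 _] := sem_typ S2; have [df cf] := sem_typ S; have [dg cg] := gmor_typ g.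
rewrite compA ?df2 ?cf //; first exact: sem_cons (IH _ _ S2).
by rewrite df !cod_tmor !cod_idm cg !wob_cat tobA.
Qed.

Lemma sem_cat_inv w d1 d2 u f : sem w (d1 ++ d2) u f ->
  exists v f1 f2, [/\ sem w d1 v f1, sem v d2 u f2 & f = f2 ∘ f1].
Proof.
elim: d1 w f => [|[k g] d1 IH] w f /= S.
  exists w, (idm (wob w)), f; split=> //; first exact: sem_nil.
  by have [<- _] := sem_typ S; rewrite comp_idr.
have [l [r [f' [-> /= <- S' ->]]]] := sem_inv S.
have [v [f1 [f2 [S1 S2 E]]]] := IH _ _ S'.
have [df2 _] := sem_typ S2; have [df1 cf1] := sem_typ S1; have [dg cg] := gmor_typ g.
exists v, (f1 ∘ (idm (wob l) ⊗ gmor g ⊗ idm (wob r))), f2; split=> //.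
  exact: sem_cons.
rewrite E compA ?df2 ?cf1 //.
by rewrite df1 !cod_tmor !cod_idm cg !wob_cat tobA.
Qed.

Lemma sem_target w d v f : sem w d v f -> target wty w d = Some v.
Proof.
elim=> //= l g r d' v' f' _ <-.
rewrite /lcod /= size_cat leq_addr drop_size_cat // take_size_cat // eqxx /=.
by rewrite take_size_cat // drop_size_cat.
Qed.

Lemma sem_whisker w d v f l r : sem w d v f ->
  sem (l ++ w ++ r) (shift (size l) d) (l ++ v ++ r)
    (idm (wob l) ⊗ f ⊗ idm (wob r)).
Proof.
elim=> [w'|l' g r' d' v' f' S IH] /=.
  by rewrite !tmor_idm -!wob_cat -catA; exact: sem_nil.
have [df' cf'] := sem_typ S; have [dg cg] := gmor_typ g.
have -> : idm (wob l) ⊗ (f' ∘ (idm (wob l') ⊗ gmor g ⊗ idm (wob r'))) ⊗ idm (wob r)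
  = (idm (wob l) ⊗ f' ⊗ idm (wob r))
    ∘ (idm (wob (l ++ l')) ⊗ gmor g ⊗ idm (wob (r' ++ r))).
  have idc a : idm (wob a) = idm (wob a) ∘ idm (wob a).
    by rewrite -{2}(cod_idm (wob a)) comp_idl.
  rewrite {1}(idc l) {1}(idc r) tmor_comp ?tmor_comp ?dom_tmor ?cod_tmor ?dom_idm ?cod_idm //.
  - by rewrite !wob_cat -!tmor_idm !tmorA.
  - by rewrite df' cg !wob_cat !tobA.
  - by rewrite df' cg !wob_cat tobA.
have E : l ++ (l' ++ gin g ++ r') ++ r = (l ++ l') ++ gin g ++ (r' ++ r).
  by rewrite !catA.
rewrite E -size_cat.
by apply: sem_cons; rewrite -!catA in IH *.
Qed.

(** The two branches of [commute] are this equation read in its two directions, with [m] the strands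
    between the boxes. *)
Lemma interchange l m r g1 g2 :
  (idm (wob l) ⊗ gmor g1 ⊗ idm (wob (m ++ gout g2 ++ r)))
    ∘ (idm (wob (l ++ gin g1 ++ m)) ⊗ gmor g2 ⊗ idm (wob r))
  = (idm (wob (l ++ gout g1 ++ m)) ⊗ gmor g2 ⊗ idm (wob r))
    ∘ (idm (wob l) ⊗ gmor g1 ⊗ idm (wob (m ++ gin g2 ++ r))).
Proof.
have idc a : idm (wob a) ∘ idm (wob a) = idm (wob a).
  by rewrite -{1}(cod_idm (wob a)) comp_idl.
have gl g : gmor g ∘ idm (wob (gin g)) = gmor g.
  by have [<- _] := gmor_typ g; rewrite comp_idr.
have gr g : idm (wob (gout g)) ∘ gmor g = gmor g.
  by have [_ <-] := gmor_typ g; rewrite comp_idl.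
have [dg1 cg1] := gmor_typ g1; have [dg2 cg2] := gmor_typ g2.
rewrite !wob_cat -!tmor_idm !tmorA.
by rewrite -!tmor_comp ?cod_tmor ?dom_tmor ?cod_idm ?dom_idm ?dg1 ?dg2 ?cg1 ?cg2 //
   ?idc ?gl ?gr.
Qed.

Lemma cat_split (a b c d : word) : a ++ b = c ++ d -> size a <= size c ->
  exists m, c = a ++ m /\ b = m ++ d.
Proof.
elim: a c => [|x a IH] [|y c] //=; first by move=> ->; exists [::].
  by move=> -> _; exists (y :: c).
by case=> <- /IH H /H [m [-> ->]]; exists m.
Qed.

Lemma commute_sem w x y d v f y' x' :
  commute wty x y = Some (y', x') ->
  sem w (x :: y :: d) v f -> sem w (y' :: x' :: d) v f.
Proof.
case: x y => [k1 g1] [k2 g2]; rewrite /commute /= => E.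
case/sem_inv=> l1 [r1 [f1 [-> /= k1E S1 ->]]]; subst k1.
case/sem_inv: S1 => l2 [r2 [f2 [Ew /= k2E S2 ->]]]; subst k2.
have [dg1 cg1] := gmor_typ g1; have [dg2 cg2] := gmor_typ g2.
have [df2 _] := sem_typ S2.
case: leqP E => [le|_].
  rewrite -size_cat catA in Ew le; have [m [l2E r1E]] := cat_split Ew le.
  case=> <- <-; subst l2 r1; rewrite -!catA in S2 df2 *.
  rewrite -compA; first last.
  - by rewrite !cod_tmor !dom_tmor !dom_idm !cod_idm cg1 dg2 !wob_cat !tobA.
  - by rewrite df2 !cod_tmor !cod_idm cg2 !wob_cat !tobA.
  rewrite -interchange compA; first last.
  - by rewrite !cod_tmor !dom_tmor !dom_idm !cod_idm dg1 cg2 !wob_cat !tobA.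
  - by rewrite df2 !cod_tmor !cod_idm cg1 !wob_cat !tobA.
  have -> : size (l1 ++ gout g1 ++ m) - size (gout g1) + size (gin g1)
    = size (l1 ++ gin g1 ++ m) by rewrite !size_cat addnCA addKn addnAC addnA.
  have -> : l1 ++ gin g1 ++ m ++ gin g2 ++ r2 = (l1 ++ gin g1 ++ m) ++ gin g2 ++ r2.
    by rewrite !catA.
  apply: sem_cons; move: (sem_cons (g := g1) (l := l1) (r := m ++ gout g2 ++ r2)).
  by rewrite -!catA; apply.
case: leqP => // le [<- <-].
rewrite -size_cat in le.
have [m [l1E r2E]] := cat_split (etrans (esym (catA _ _ _)) (esym Ew)) le.
subst l1 r2; rewrite -!catA in S2 df2 *.
rewrite -compA; first last.
- by rewrite !cod_tmor !dom_tmor !dom_idm !cod_idm cg1 dg2 !wob_cat !tobA.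
- by rewrite df2 !cod_tmor !cod_idm cg2 !wob_cat !tobA.
rewrite interchange compA; first last.
- by rewrite !cod_tmor !dom_tmor !dom_idm !cod_idm dg1 cg2 !wob_cat !tobA.
- by rewrite df2 !cod_tmor !cod_idm cg1 !wob_cat !tobA.
have -> : size (l2 ++ gin g2 ++ m) - size (gin g2) + size (gout g2)
  = size (l2 ++ gout g2 ++ m) by rewrite !size_cat addnCA addKn addnAC addnA.
apply: sem_cons.
have -> : l2 ++ gout g2 ++ m ++ gin g1 ++ r1 = (l2 ++ gout g2 ++ m) ++ gin g1 ++ r1.
  by rewrite !catA.
by apply: sem_cons; rewrite -!catA.
Qed.

Lemma sem_congr w x d d' v f :
  (forall w' v' f', sem w' d v' f' -> sem w' d' v' f') ->
  sem w (x :: d) v f -> sem w (x :: d') v f.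
Proof.
by case: x => k g E /sem_inv [l [r [f' [-> /= <- S ->]]]]; apply/sem_cons/E.
Qed.

Lemma lift_sem w b x x' b' d v f :
  lift wty b x = Some (x', b') -> sem w (b ++ x :: d) v f -> sem w (x' :: b' ++ d) v f.
Proof.
elim: b x' b' w v f => [|y b IH] x' b' w v f /=; first by case=> <- <-.
case: (lift _ b x) IH => [[x1 b1]|] // IH.
case E: (commute _ y x1) => [[x2 y']|] // [<- <-] S.
by apply: commute_sem E _; apply: sem_congr S => *; apply: IH.
Qed.

Lemma lift_gen b x x' b' : lift wty b x = Some (x', b') -> x'.2 = x.2.
Proof.
elim: b x' b' => [|z b IH] x' b' /=; first by case=> <-.
case: (lift _ b x) IH => [[y1 p1]|] // IH; rewrite /commute.
by case: ifP => _; [|case: ifP => // _]; case=> <- _; rewrite (IH _ _ erefl).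
Qed.

Lemma extract_sem w x pre d d' v f :
  d' \in extract wty x pre d -> sem w (pre ++ d) v f -> sem w (x :: d') v f.
Proof.
elim: d pre => [|y d IH] pre //=.
have next : d' \in extract wty x (rcons pre y) d ->
  sem w (pre ++ y :: d) v f -> sem w (x :: d') v f by rewrite -cat_rcons; exact: IH.
case: eqP => // Eg; case E: (lift _ pre y) => [[y' pre']|] //; case: eqP => // Ek.
rewrite inE => /orP[/eqP-> S|//].
have -> : x = y'.
  by move: (lift_gen E) Eg Ek; case: x y y' {IH E next S} => [? ?] [? ?] [? ?] /= -> -> ->.
exact: lift_sem E S.
Qed.

Lemma isotopic_sem w d e v f : isotopic wty d e -> sem w e v f -> sem w d v f.
Proof.
elim: d e w v f => [|x d IH] e w v f /=; first by move/nilP->.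
case/hasP=> e' E I S.
by apply: sem_congr (extract_sem E (S : sem w ([::] ++ e) v f)) => *; apply: IH I _.
Qed.

(** The hexagon axiom with both factors equal to the unit object makes this braiding idempotent, and
    an invertible idempotent is an identity. The same argument gives [Psi_tun_l]. *)
Lemma Psi_tun_r (a : obj K) : Psi a tun = idm a.
Proof.
have [g [dg cg E _]] := Psi_inv a (tun : obj K).
move: dg cg E; rewrite !(tob1r, tob1l) => dg cg E.
have := Psi_tobr a (tun : obj K) tun; rewrite tob1l tmor1l tmor1r => /(congr1 (comp g)).
rewrite compA ?cod_Psi ?dom_Psi ?dg ?tob1l ?tob1r // E.
by rewrite -{2}(tob1l a) -cod_Psi comp_idl.
Qed.

Lemma Psi_tun_l (a : obj K) : Psi tun a = idm a.
Proof.
have [g [dg cg E _]] := Psi_inv (tun : obj K) a.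
move: dg cg E; rewrite !(tob1r, tob1l) => dg cg E.
have := Psi_tobl (tun : obj K) tun a; rewrite tob1l tmor1l tmor1r => /(congr1 (comp g)).
rewrite compA ?cod_Psi ?dom_Psi ?dg ?tob1l ?tob1r // E.
by rewrite -{2}(tob1r a) -cod_Psi comp_idl.
Qed.

Lemma sem_shift l w d v f : sem w d v f ->
  sem (l ++ w) (shift (size l) d) (l ++ v) (idm (wob l) ⊗ f).
Proof. by move/(sem_whisker l [::]); rewrite !cats0 tmor1r. Qed.

Lemma shift0 d : shift 0 d = d.
Proof. by elim: d => //= [[k g] d ->]. Qed.

Lemma sem_whisker_r w d v f r : sem w d v f ->
  sem (w ++ r) d (v ++ r) (f ⊗ idm (wob r)).
Proof. by move/(sem_whisker [::] r); rewrite /= shift0 tmor1l. Qed.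

Lemma shift_braid1 k i a v : shift k (braid1 i a v) = braid1 (k + i) a v.
Proof. by elim: v i => //= b v IH i; rewrite IH addnS. Qed.

Lemma braid1_sem a v : sem (a :: v) (braid1 0 a v) (v ++ [:: a]) (Psi (ob a) (wob v)).
Proof.
elim: v => [|b v IH] /=.
  by rewrite Psi_tun_r -[ob a]tob1r; exact: (sem_nil [:: a]).
rewrite Psi_tobr.
have := sem_shift [:: b] IH; rewrite /= shift_braid1 tob1r => S.
have := sem_cons (l := [::]) (g := inr (a, b)) (r := v) S.
by rewrite /= tmor1l.
Qed.

Lemma braid_sem u v : sem (u ++ v) (braid u v) (v ++ u) (Psi (wob u) (wob v)).
Proof.
elim: u => [|a u IH] /=; first by rewrite cats0 Psi_tun_l; exact: sem_nil.
rewrite Psi_tobl -[a :: u]cat1s catA.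
apply: sem_cat; first by have := sem_shift [:: a] IH; rewrite /= tob1r; apply.
exact: sem_whisker_r (braid1_sem a v).
Qed.

Lemma compile_sem e u d v : compile wty e = Some (u, d, v) -> sem u d v (den e).
Proof.
elim: e u d v => [o|n|a b|f IHf g IHg|f IHf g IHg] u d v /=.
- by case=> <- <- <-; rewrite oden_flat; exact: sem_nil.
- case=> <- <- <-; have [dg cg] := gmor_typ (inl n).
  have S := sem_cons (l := [::]) (g := inl n) (r := [::]) (sem_nil _).
  move: S; rewrite !cats0 /= tmor1l tmor1r -cg comp_idl; apply.
- by case=> <- <- <-; rewrite !oden_flat; exact: braid_sem.
- case: (compile _ g) IHg => [[[u1 dg] v1]|] // IHg.
  case: (compile _ f) IHf => [[[v2 df] w]|] // IHf.
  by case: eqP => // E [<- <- <-]; subst v2; apply: sem_cat; [exact: IHg | exact: IHf].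
case: (compile _ f) IHf => [[[u1 df] v1]|] // /(_ _ _ _ erefl) Sf.
case: (compile _ g) IHg => [[[u2 dg] v2]|] // /(_ _ _ _ erefl) Sg [<- <- <-].
(* This is the order chosen by [compile]: the layers of [f] come before those of [g]. *)
have -> : den f ⊗ den g = (idm (wob v1) ⊗ den g) ∘ (den f ⊗ idm (wob u2)).
  have [df' cf'] := sem_typ Sf; have [dg' cg'] := sem_typ Sg.
  by rewrite -tmor_comp ?cod_idm ?dom_idm ?cf' ?dg' // -cf' comp_idl -dg' comp_idr.
exact: sem_cat (sem_whisker_r u2 Sf) (sem_shift v1 Sg).
Qed.

Definition sound (r : rule) : Prop :=
  let: (u, d1, d2) := r in exists v f, sem u d1 v f /\ sem u d2 v f.

Lemma crule_sound r : den r.1 = den r.2 -> sound (crule wty r).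
Proof.
have sound0 : sound ([::], [::], [::]).
  by exists [::], (idm (wob [::])); split; exact: sem_nil.
rewrite /crule; case: r => e1 e2 /= E.
case E1: (compile _ e1) => [[[u d1] v]|] //; case E2: (compile _ e2) => [[[u' d2] v']|] //.
case: andP => // -[/eqP Eu /eqP Ev]; subst u' v'.
by exists v, (den e1); split; [exact: compile_sem E1 | rewrite E; exact: compile_sem E2].
Qed.

Lemma rewr_sem w d i k r d' v f :
  sound r -> rewr wty w d i k r = Some d' -> sem w d v f -> sem w d' v f.
Proof.
case: r => [[u d1] d2] /= [v0 [f0 [S1 S2]]] E S.
rewrite -(cat_take_drop i d) in S.
have [w1 [f1 [f2 [Sp Sq ->]]]] := sem_cat_inv S.
move: E; rewrite (sem_target Sp).
case: and3P => // -[le /eqP Eu /eqP E1] [<-].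
apply: sem_cat Sp _.
move: Sq; rewrite -{1}(cat_take_drop (size d1) (drop i d)) E1.
have -> : k = size (take k w1) by rewrite size_take_min; exact/esym/minn_idPl.
rewrite -{1 3}(cat_take_drop k w1) -{1 2}(cat_take_drop (size u) (drop k w1)) Eu.
set l := take k w1; set rr := drop _ _.
case/sem_cat_inv=> [w2 [g1 [g2 [T1 T2 ->]]]].
have [Ew Eg] := sem_det T1 (sem_whisker l rr S1); subst w2 g1.
by apply: sem_cat T2; exact: sem_whisker.
Qed.

Lemma exec_sem rs w d t d' v f :
  (forall n, sound (nth ([::], [::], [::]) rs n)) ->
  exec wty rs w d t = Some d' -> sem w d v f -> sem w d' v f.
Proof.
move=> R; elim: t d => [|[[[n i] k] c] t IH] d /=; first by case=> <-.
case I: (isotopic _ c d) => //; case E: (rewr _ _ _ _ _ _) => [d1|] // X S.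
by apply: IH X _; apply: rewr_sem (R n) E _; exact: isotopic_sem I S.
Qed.

Lemma check_sound rs e1 e2 t1 t2 : holds rs -> check wty rs e1 e2 t1 t2 -> den e1 = den e2.
Proof.
move=> hrs.
have R n : sound (nth ([::], [::], [::]) [seq crule wty r | r <- rs] n).
  elim: rs hrs n => [|r rs IH] /=; last first.
    by move=> [Er /IH{}IH] [|n] //=; exact: crule_sound.
  by move=> _ n; rewrite nth_nil; exists [::], (idm (wob [::])); split; exact: sem_nil.
rewrite /check.
case E1: (compile _ e1) => [[[u d1] v1]|] //; case E2: (compile _ e2) => [[[u' d2] v2]|] //.
case: eqP => // Eu; subst u'.
case X1: (exec _ _ _ d1 _) => [d1'|] //; case X2: (exec _ _ _ d2 _) => [d2'|] // I.
have S1 := exec_sem R X1 (compile_sem E1); have S2 := exec_sem R X2 (compile_sem E2).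
by have [] := sem_det S1 (isotopic_sem I S2).
Qed.

Lemma oden_oword w : oden (oword w) = wob w.
Proof. by rewrite oden_flat flat_oword. Qed.

Lemma den_egen g : den (egen g) = gmor g.
Proof. by case: g => [n|[a b]]. Qed.

Lemma natL_holds g c : den (natL wty g c).1 = den (natL wty g c).2.
Proof.
rewrite /= den_egen !oden_oword; have [dg cg] := gmor_typ g.
by have := Psi_nat (idm (ob c)) (gmor g); rewrite dg cg dom_idm cod_idm.
Qed.

Lemma natR_holds g c : den (natR wty g c).1 = den (natR wty g c).2.
Proof.
rewrite /= den_egen !oden_oword; have [dg cg] := gmor_typ g.
by have := Psi_nat (gmor g) (idm (ob c)); rewrite dg cg dom_idm cod_idm.
Qed.

Lemma holds_cat rs rs' : holds rs -> holds rs' -> holds (rs ++ rs').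
Proof. by elim: rs => //= r rs IH [? /IH H] /H. Qed.

Lemma holds_flatten (T : Type) (F : T -> seq (expr * expr)) s :
  (forall x, holds (F x)) -> holds (flatten [seq F x | x <- s]).
Proof. by move=> H; elim: s => //= x s IH; apply: holds_cat. Qed.

Lemma nat_rules_hold n : holds (nat_rules wty n).
Proof.
apply: holds_cat; do 2 apply: holds_flatten => ?.
  have hflip b r : den r.1 = den r.2 -> den (flip b r).1 = den (flip b r).2 by case: b.
  by split; [apply/hflip/natL_holds | split=> //; apply/hflip/natR_holds].
by elim: (iota 0 n) => // c s IH; split=> //; exact: natL_holds.
Qed.

Lemma diagram_sound rs n e1 e2 t1 t2 :
  holds rs -> check wty (rs ++ nat_rules wty n) e1 e2 t1 t2 -> den e1 = den e2.
Proof. by move=> hrs; apply: check_sound; apply: holds_cat hrs (nat_rules_hold n). Qed.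

(** With [den_cod], this is typing by reflection: side conditions on domains and codomains become
    equalities of computed words. *)
Lemma den_dom e u d v : compile wty e = Some (u, d, v) -> dom (den e) = wob u.
Proof. by move=> /compile_sem/sem_typ[]. Qed.

Lemma den_cod e u d v : compile wty e = Some (u, d, v) -> cod (den e) = wob v.
Proof. by move=> /compile_sem/sem_typ[]. Qed.

End Semantics.

(** * Reification of goals, and the tactics [diagram] and [typ] *)

Ltac list_mem x l :=
  lazymatch l with
  | nil => constr:(false)
  | cons x _ => constr:(true)
  | cons _ ?t => list_mem x t
  end.
Ltac list_add x l :=
  let b := list_mem x l in
  lazymatch b with true => l | false => constr:(cons x l) end.
Ltac list_index x l :=
  lazymatch l with
  | cons x _ => constr:(O)
  | cons _ ?t => let n := list_index x t in constr:(S n)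
  end.

(** The concrete bimodules must show their two strands for the rules of H, B and C to apply; an
    abstract Hopf bimodule stays a single strand. *)
Ltac unfold_carrier o :=
  lazymatch o with
  | hcar (hbim_ltimes ?H ?B) => constr:(tob H B)
  | hcar (hbim_rtimes ?H ?C) => constr:(tob C H)
  | hcar (hbim_unit ?H) => constr:(car H)
  | _ => o
  end.
Ltac add_objs o l :=
  let o := unfold_carrier o in
  lazymatch o with
  | tun => l
  | tob ?a ?b => let l := add_objs a l in add_objs b l
  | _ => list_add o l
  end.
Ltac reify_obj os o :=
  let o := unfold_carrier o in
  lazymatch o with
  | tun => constr:(O1)
  | tob ?a ?b =>
      let a' := reify_obj os a in let b' := reify_obj os b in constr:(OT a' b')
  | _ => let n := list_index o os in constr:(OA n)
  end.

(* Environments are pairs (objects, boxes); the type of a box is read off the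
   context. *)
Ltac box_type f :=
  match goal with
  | H : dom f = ?a /\ cod f = ?b |- _ => constr:((a, b))
  | H : @dom _ f = ?a /\ @cod _ f = ?b |- _ => constr:((a, b))
  | _ => fail 100 "no type for" f
  end.
Ltac box_proof f :=
  match goal with
  | H : dom f = _ /\ cod f = _ |- _ => constr:(H)
  end.

(* The braidings of the categories of right and left H-crossed modules. *)
Definition rbraid (K : sbmc) (H : bialg_data K) (B : xbialg_data K) : mor K :=
  (idm B ⊗ act B) ∘ (Psi B B ⊗ idm H) ∘ (idm B ⊗ coact B).
Definition lbraid (K : sbmc) (H : bialg_data K) (C : xbialg_data K) : mor K :=
  (act C ⊗ idm C) ∘ (idm H ⊗ Psi C C) ∘ (coact C ⊗ idm C).

Ltac unfold_tens1 f :=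
  lazymatch f with
  | lact_tens _ _ _ _ _ => eval unfold lact_tens in f
  | ract_tens _ _ _ _ _ => eval unfold ract_tens in f
  | lcoact_tens _ _ _ _ _ => eval unfold lcoact_tens in f
  | rcoact_tens _ _ _ _ _ => eval unfold rcoact_tens in f
  | rbraid _ _ => eval unfold rbraid in f
  | lbraid _ _ => eval unfold lbraid in f
  | lact (hbim_ltimes _ _) => eval cbn in f
  | ract (hbim_ltimes _ _) => eval cbn in f
  | lcoact (hbim_ltimes _ _) => eval cbn in f
  | rcoact (hbim_ltimes _ _) => eval cbn in f
  | lact (hbim_rtimes _ _) => eval cbn in f
  | ract (hbim_rtimes _ _) => eval cbn in f
  | lcoact (hbim_rtimes _ _) => eval cbn in f
  | rcoact (hbim_rtimes _ _) => eval cbn in f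
  | lact (hbim_unit _) => eval cbn in f
  | ract (hbim_unit _) => eval cbn in f
  | lcoact (hbim_unit _) => eval cbn in f
  | rcoact (hbim_unit _) => eval cbn in f
  | _ => f
  end.

(** Two passes, since the projection of a concrete bimodule may produce a diagonal action or
    coaction that has to be unfolded as well. *)
Ltac unfold_tens f := let f := unfold_tens1 f in unfold_tens1 f.

Ltac add_mor f env :=
  let f := unfold_tens f in
  lazymatch f with
  | idm ?o => lazymatch env with (?os, ?gs) =>
      let os := add_objs o os in constr:((os, gs)) end
  | Psi ?a ?b => lazymatch env with (?os, ?gs) =>
      let os := add_objs a os in let os := add_objs b os in constr:((os, gs)) end
  | comp ?g ?h => let env := add_mor g env in add_mor h env
  | tmor ?g ?h => let env := add_mor g env in add_mor h env
  | _ => lazymatch env with (?os, ?gs) =>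
      let b := list_mem f gs in
      lazymatch b with
      | true => env
      | false =>
          let t := box_type f in
          lazymatch t with (?a, ?b) =>
            let os := add_objs a os in let os := add_objs b os in
            constr:((os, cons f gs)) end
      end end
  end.
Ltac reify_mor os gs f :=
  let f := unfold_tens f in
  lazymatch f with
  | idm ?o => let o' := reify_obj os o in constr:(EI o')
  | Psi ?a ?b =>
      let a' := reify_obj os a in let b' := reify_obj os b in constr:(EX a' b')
  | comp ?g ?h =>
      let g' := reify_mor os gs g in let h' := reify_mor os gs h in constr:(EC g' h')
  | tmor ?g ?h =>
      let g' := reify_mor os gs g in let h' := reify_mor os gs h in constr:(ET g' h')
  | _ => let n := list_index f gs in constr:(EB n)
  end.

Ltac add_rules rs env :=
  lazymatch rs with
  | tt => env
  | (?r1, ?r2) => let env := add_rules r1 env in add_rules r2 env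
  | ?r => let t := type of r in
          let t := eval unfold rmod_mor, lmod_mor, rcom_mor, lcom_mor in t in
          lazymatch t with ?f = ?g =>
            let env := add_mor f env in add_mor g env end
  end.
Ltac reify_rules os gs rs acc :=
  lazymatch rs with
  | tt => acc
  | (?r1, ?r2) => let acc := reify_rules os gs r2 acc in reify_rules os gs r1 acc
  | ?r => let t := type of r in
          let t := eval unfold rmod_mor, lmod_mor, rcom_mor, lcom_mor in t in
          lazymatch t with ?f = ?g =>
            let f' := reify_mor os gs f in let g' := reify_mor os gs g in
            lazymatch acc with (?l, ?p) => constr:((cons (f', g') l, conj r p)) end end
  end.
Ltac reify_types os gs :=
  lazymatch gs with
  | nil => constr:((@nil (oexp * oexp), I))
  | cons ?g ?gs' =>
      let acc := reify_types os gs' in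
      let t := box_type g in
      let p := box_proof g in
      lazymatch t with (?a, ?b) =>
        let a' := reify_obj os a in let b' := reify_obj os b in
        lazymatch acc with (?l, ?q) => constr:((cons (a', b') l, conj p q)) end end
  end.

Ltac reify_env env :=
  lazymatch env with (?os, ?gs) => let tys := reify_types os gs in
    constr:((os, gs, tys)) end.

Ltac diagram_with fuel rs :=
  lazymatch goal with |- @eq (mor ?K) ?f ?g =>
    let env := constr:((@nil (obj K), @nil (mor K))) in
    let env := add_mor f env in let env := add_mor g env in
    let env := add_rules rs env in
    lazymatch env with (?os, ?gs) =>
      let f' := reify_mor os gs f in
      let g' := reify_mor os gs g in
      let tys := reify_types os gs in
      lazymatch tys with (?ty, ?pty) =>
        let rp := reify_rules os gs rs constr:((@nil (expr * expr), I)) in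
        lazymatch rp with (?rl, ?rpf) =>
          let n := eval compute in (size os) in
          let wt := eval compute in (wty ty) in
          let s1 := eval vm_compute in (search wt fuel (rl ++ nat_rules wt n) f') in
          let s2 := eval vm_compute in (search wt fuel (rl ++ nat_rules wt n) g') in
          lazymatch s1 with (?t1, ?d1) =>
            lazymatch s2 with (?t2, ?d2) =>
              let b := eval vm_compute in (isotopic wt d1 d2) in
              lazymatch b with
              | true =>
                refine (@diagram_sound K os gs ty pty rl n f' g' t1 t2 rpf _);
                vm_cast_no_check (erefl true)
              | false => fail "the normal forms differ"
              end
            end
          end
        end
      end
    end
  end.

(* Proves an equality of morphisms whose sides have the same normal form for the
   equations [rs], read from left to right, and for the naturality of the
   braiding.  The types of the boxes must be hypotheses of the form
   [f ::: a ~> b]: this is why such facts are introduced in the sections and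
   proofs below without being mentioned again. *)
Tactic Notation "diagram" constr(rs) := diagram_with 1000 rs.
Tactic Notation "diagram" := diagram_with 1000 tt.

Ltac den_end x env :=
  lazymatch env with (?os, ?gs, (?ty, ?pty)) =>
    lazymatch x with
    | @dom ?K ?f =>
        let f' := reify_mor os gs f in
        let c := eval vm_compute in (compile (wty ty) f') in
        lazymatch c with Some (?u, ?d, ?v) =>
          constr:(@den_dom K os gs ty pty f' u d v (erefl (Some (u, d, v)))) end
    | @cod ?K ?f =>
        let f' := reify_mor os gs f in
        let c := eval vm_compute in (compile (wty ty) f') in
        lazymatch c with Some (?u, ?d, ?v) =>
          constr:(@den_cod K os gs ty pty f' u d v (erefl (Some (u, d, v)))) end
    | ?o => let K := lazymatch type of o with obj ?K => K end in
        let o' := reify_obj os o in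
        let w := eval compute in (flat o') in
        constr:(@oden_flat K os o' : _ = wob os w)
    end
  end.
Ltac add_end x env :=
  lazymatch x with
  | dom ?f => add_mor f env
  | cod ?f => add_mor f env
  | ?o => lazymatch env with (?os, ?gs) =>
            let os := add_objs o os in constr:((os, gs)) end
  end.
Ltac typ_eq :=
  lazymatch goal with |- @eq (obj ?K) ?x ?y =>
    let env := constr:((@nil (obj K), @nil (mor K))) in
    let env := add_end x env in let env := add_end y env in
    let env := reify_env env in
    let p := den_end x env in let q := den_end y env in
    exact (etrans p (esym q))
  end.
Ltac typ :=
  lazymatch goal with
  | |- _ /\ _ => split; typ_eq
  | |- _ => typ_eq
  end.

Lemma the_spec (K : sbmc) (P : mor K -> Prop) : (exists f, P f) -> P (the P).
Proof. exact: epsilon_spec. Qed.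

Ltac the_intro :=
  unfold hmap, hassoc, hassocV, hbraid, hunit, hunitV;
  lazymatch goal with |- context [the ?P] => apply (@the_spec _ P) end.

(** * Rules for bialgebras, crossed modules and Hopf bimodules *)

Section BialgebraFacts.
Variables (K : sbmc) (psi : mor K) (A : bialg_data K).
Hypothesis hA : bialgebra_for psi A.

Lemma mul_typ : mul A ::: A ⊠ A ~> A. Proof. by case: hA => -[]. Qed.
Lemma eta_typ : eta A ::: tun ~> A. Proof. by case: hA => -[]. Qed.
Lemma Delta_typ : Delta A ::: A ~> A ⊠ A. Proof. by case: hA => _ []. Qed.
Lemma eps_typ : eps A ::: A ~> tun. Proof. by case: hA => _ []. Qed.
Lemma mulA : mul A ∘ (mul A ⊗ idm A) = mul A ∘ (idm A ⊗ mul A).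
Proof. by case: hA => -[]. Qed.
Lemma mul1l : mul A ∘ (eta A ⊗ idm A) = idm A. Proof. by case: hA => -[]. Qed.
Lemma mul1r : mul A ∘ (idm A ⊗ eta A) = idm A. Proof. by case: hA => -[]. Qed.
Lemma DeltaA : (Delta A ⊗ idm A) ∘ Delta A = (idm A ⊗ Delta A) ∘ Delta A.
Proof. by case: hA => _ []. Qed.
Lemma Delta1l : (eps A ⊗ idm A) ∘ Delta A = idm A. Proof. by case: hA => _ []. Qed.
Lemma Delta1r : (idm A ⊗ eps A) ∘ Delta A = idm A. Proof. by case: hA => _ []. Qed.
Lemma Delta_mul : Delta A ∘ mul A
  = (mul A ⊗ mul A) ∘ (idm A ⊗ psi ⊗ idm A) ∘ (Delta A ⊗ Delta A).
Proof. by case: hA. Qed.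
Lemma Delta_eta : Delta A ∘ eta A = eta A ⊗ eta A. Proof. by case: hA. Qed.
Lemma eps_mul : eps A ∘ mul A = eps A ⊗ eps A. Proof. by case: hA => _ _ _ _ []. Qed.
Lemma eps_eta : eps A ∘ eta A = idm tun. Proof. by case: hA => _ _ _ _ []. Qed.
End BialgebraFacts.

Ltac bialg_types h := move: (mul_typ h) (eta_typ h) (Delta_typ h) (eps_typ h) => ? ? ? ?.
Notation bialg_rules h :=
  (mulA h, mul1l h, mul1r h, DeltaA h, Delta1l h, Delta1r h, Delta_mul h,
   Delta_eta h, eps_mul h, eps_eta h).

(* For left modules, iterated products and coproducts are nested to the left. *)
Notation bialg_rules_l h :=
  (esym (mulA h), mul1l h, mul1r h, esym (DeltaA h), Delta1l h, Delta1r h, Delta_mul h,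
   Delta_eta h, eps_mul h, eps_eta h).

Section CrossedFacts.
Variables (K : sbmc) (H : bialg_data K).
Implicit Types B C : xbialg_data K.

Section Right.
Variable B : xbialg_data K.
Hypothesis hB : right_crossed_bialgebra H B.

Lemma rcb_bialg : bialgebra_for (rbraid H B) B. Proof. by case: hB. Qed.
Lemma rcb_act_typ : act B ::: B ⊠ H ~> B. Proof. by case: hB => -[[]]. Qed.
Lemma rcb_coact_typ : coact B ::: B ~> B ⊠ H. Proof. by case: hB => -[_ []]. Qed.
Lemma rcb_actA : act B ∘ (act B ⊗ idm H) = act B ∘ (idm B ⊗ mul H).
Proof. by case: hB => -[[]]. Qed.
Lemma rcb_act1 : act B ∘ (idm B ⊗ eta H) = idm B. Proof. by case: hB => -[[]]. Qed.
Lemma rcb_coactA : (coact B ⊗ idm H) ∘ coact B = (idm B ⊗ Delta H) ∘ coact B.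
Proof. by case: hB => -[_ []]. Qed.
Lemma rcb_coact1 : (idm B ⊗ eps H) ∘ coact B = idm B. Proof. by case: hB => -[_ []]. Qed.
Lemma rcb_crossed : (act B ⊗ mul H) ∘ (idm B ⊗ Psi H H ⊗ idm H) ∘ (coact B ⊗ Delta H)
  = (idm B ⊗ mul H) ∘ (Psi H B ⊗ idm H) ∘ (idm H ⊗ (coact B ∘ act B))
      ∘ (Psi B H ⊗ idm H) ∘ (idm B ⊗ Delta H).
Proof. by case: hB => -[]. Qed.
Lemma rcb_act_mul : act B ∘ (mul B ⊗ idm H) = mul B ∘ ract_tens H B B (act B) (act B).
Proof. by case: hB => _ [-> _ _ _]. Qed.
Lemma rcb_act_eta : act B ∘ (eta B ⊗ idm H) = eta B ∘ eps H.
Proof. by case: hB => _ [_ -> _ _]. Qed.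
Lemma rcb_Delta_act : Delta B ∘ act B = ract_tens H B B (act B) (act B) ∘ (Delta B ⊗ idm H).
Proof. by case: hB => _ [_ _ -> _]. Qed.
Lemma rcb_eps_act : eps B ∘ act B = eps H ∘ (eps B ⊗ idm H).
Proof. by case: hB => _ [_ _ _ ->]. Qed.
Lemma rcb_coact_mul :
  coact B ∘ mul B = (mul B ⊗ idm H) ∘ rcoact_tens H B B (coact B) (coact B).
Proof. by case: hB => _ _ [-> _ _ _]. Qed.
Lemma rcb_coact_eta : coact B ∘ eta B = (eta B ⊗ idm H) ∘ eta H.
Proof. by case: hB => _ _ [_ -> _ _]. Qed.
Lemma rcb_Delta_coact :
  (Delta B ⊗ idm H) ∘ coact B = rcoact_tens H B B (coact B) (coact B) ∘ Delta B.
Proof. by case: hB => _ _ [_ _ -> _]. Qed.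
Lemma rcb_eps_coact : (eps B ⊗ idm H) ∘ coact B = eta H ∘ eps B.
Proof. by case: hB => _ _ [_ _ _ ->]. Qed.
End Right.

Section Left.
Variable C : xbialg_data K.
Hypothesis hC : left_crossed_bialgebra H C.

Lemma lcb_bialg : bialgebra_for (lbraid H C) C. Proof. by case: hC. Qed.
Lemma lcb_act_typ : act C ::: H ⊠ C ~> C. Proof. by case: hC => -[[]]. Qed.
Lemma lcb_coact_typ : coact C ::: C ~> H ⊠ C. Proof. by case: hC => -[_ []]. Qed.
Lemma lcb_actA : act C ∘ (idm H ⊗ act C) = act C ∘ (mul H ⊗ idm C).
Proof. by case: hC => -[[]]. Qed.
Lemma lcb_act1 : act C ∘ (eta H ⊗ idm C) = idm C. Proof. by case: hC => -[[]]. Qed.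
Lemma lcb_coactA : (idm H ⊗ coact C) ∘ coact C = (Delta H ⊗ idm C) ∘ coact C.
Proof. by case: hC => -[_ []]. Qed.
Lemma lcb_coact1 : (eps H ⊗ idm C) ∘ coact C = idm C. Proof. by case: hC => -[_ []]. Qed.
Lemma lcb_crossed : (mul H ⊗ act C) ∘ (idm H ⊗ Psi H H ⊗ idm C) ∘ (Delta H ⊗ coact C)
  = (mul H ⊗ idm C) ∘ (idm H ⊗ Psi C H) ∘ ((coact C ∘ act C) ⊗ idm H)
      ∘ (idm H ⊗ Psi H C) ∘ (Delta H ⊗ idm C).
Proof. by case: hC => -[]. Qed.
Lemma lcb_act_mul : act C ∘ (idm H ⊗ mul C) = mul C ∘ lact_tens H C C (act C) (act C).
Proof. by case: hC => _ [-> _ _ _]. Qed.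
Lemma lcb_act_eta : act C ∘ (idm H ⊗ eta C) = eta C ∘ eps H.
Proof. by case: hC => _ [_ -> _ _]. Qed.
Lemma lcb_Delta_act : Delta C ∘ act C = lact_tens H C C (act C) (act C) ∘ (idm H ⊗ Delta C).
Proof. by case: hC => _ [_ _ -> _]. Qed.
Lemma lcb_eps_act : eps C ∘ act C = eps H ∘ (idm H ⊗ eps C).
Proof. by case: hC => _ [_ _ _ ->]. Qed.
Lemma lcb_coact_mul :
  coact C ∘ mul C = (idm H ⊗ mul C) ∘ lcoact_tens H C C (coact C) (coact C).
Proof. by case: hC => _ _ [-> _ _ _]. Qed.
Lemma lcb_coact_eta : coact C ∘ eta C = (idm H ⊗ eta C) ∘ eta H.
Proof. by case: hC => _ _ [_ -> _ _]. Qed.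
Lemma lcb_Delta_coact :
  (idm H ⊗ Delta C) ∘ coact C = lcoact_tens H C C (coact C) (coact C) ∘ Delta C.
Proof. by case: hC => _ _ [_ _ -> _]. Qed.
Lemma lcb_eps_coact : (idm H ⊗ eps C) ∘ coact C = eta H ∘ eps C.
Proof. by case: hC => _ _ [_ _ _ ->]. Qed.
End Left.
End CrossedFacts.

Ltac rcb_types h :=
  bialg_types (rcb_bialg h); move: (rcb_act_typ h) (rcb_coact_typ h) => ? ?.
Ltac lcb_types h :=
  bialg_types (lcb_bialg h); move: (lcb_act_typ h) (lcb_coact_typ h) => ? ?.
Notation ract_rules h :=
  (rcb_actA h, rcb_act1 h, rcb_act_mul h, rcb_act_eta h, rcb_eps_act h).
Notation rcoact_rules h :=
  (rcb_coactA h, rcb_coact1 h, rcb_coact_mul h, rcb_coact_eta h, rcb_Delta_coact h,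
   rcb_eps_coact h).
Notation lact_rules h :=
  (lcb_actA h, lcb_act1 h, lcb_act_mul h, lcb_act_eta h, lcb_eps_act h).
Notation lcoact_rules h :=
  (lcb_coactA h, lcb_coact1 h, lcb_coact_mul h, lcb_coact_eta h, lcb_Delta_coact h,
   lcb_eps_coact h).

Section HopfBimoduleFacts.
Variables (K : sbmc) (H : bialg_data K) (X : hbim_data K).
Hypothesis hX : hopf_bimodule H X.
Lemma lact_typ : lact X ::: H ⊠ X ~> X. Proof. by case: hX => -[[]]. Qed.
Lemma ract_typ : ract X ::: X ⊠ H ~> X. Proof. by case: hX => -[_ []]. Qed.
Lemma lcoact_typ : lcoact X ::: X ~> H ⊠ X. Proof. by case: hX => _ -[[]]. Qed.
Lemma rcoact_typ : rcoact X ::: X ~> X ⊠ H. Proof. by case: hX => _ -[_ []]. Qed.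
Lemma lactA : lact X ∘ (idm H ⊗ lact X) = lact X ∘ (mul H ⊗ idm X).
Proof. by case: hX => -[[]]. Qed.
Lemma lact1 : lact X ∘ (eta H ⊗ idm X) = idm X. Proof. by case: hX => -[[]]. Qed.
Lemma ractA : ract X ∘ (ract X ⊗ idm H) = ract X ∘ (idm X ⊗ mul H).
Proof. by case: hX => -[_ []]. Qed.
Lemma ract1 : ract X ∘ (idm X ⊗ eta H) = idm X. Proof. by case: hX => -[_ []]. Qed.
Lemma lractA : ract X ∘ (lact X ⊗ idm H) = lact X ∘ (idm H ⊗ ract X).
Proof. by case: hX => -[]. Qed.
Lemma lcoactA : (idm H ⊗ lcoact X) ∘ lcoact X = (Delta H ⊗ idm X) ∘ lcoact X.
Proof. by case: hX => _ -[[]]. Qed.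
Lemma lcoact1 : (eps H ⊗ idm X) ∘ lcoact X = idm X.
Proof. by case: hX => _ -[[]]. Qed.
Lemma rcoactA : (rcoact X ⊗ idm H) ∘ rcoact X = (idm X ⊗ Delta H) ∘ rcoact X.
Proof. by case: hX => _ -[_ []]. Qed.
Lemma rcoact1 : (idm X ⊗ eps H) ∘ rcoact X = idm X.
Proof. by case: hX => _ -[_ []]. Qed.
Lemma lrcoactA : (lcoact X ⊗ idm H) ∘ rcoact X = (idm H ⊗ rcoact X) ∘ lcoact X.
Proof. by case: hX => _ -[]. Qed.
Lemma lcoact_lact :
  lcoact X ∘ lact X = (idm H ⊗ lact X) ∘ lcoact_tens H H X (Delta H) (lcoact X).
Proof. by case: hX => _ _ []. Qed.
Lemma rcoact_lact :
  rcoact X ∘ lact X = (lact X ⊗ idm H) ∘ rcoact_tens H H X (Delta H) (rcoact X).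
Proof. by case: hX => _ _ []. Qed.
Lemma lcoact_ract :
  lcoact X ∘ ract X = (idm H ⊗ ract X) ∘ lcoact_tens H X H (lcoact X) (Delta H).
Proof. by case: hX => _ _ _ []. Qed.
Lemma rcoact_ract :
  rcoact X ∘ ract X = (ract X ⊗ idm H) ∘ rcoact_tens H X H (rcoact X) (Delta H).
Proof. by case: hX => _ _ _ []. Qed.
End HopfBimoduleFacts.

Ltac types h := move: (lact_typ h) (ract_typ h) (lcoact_typ h) (rcoact_typ h) => ? ? ? ?.
Notation nf h := (lactA h, lact1 h, ractA h, ract1 h, lractA h, lcoactA h, lcoact1 h, rcoactA h,
  rcoact1 h, lrcoactA h, lcoact_lact h, lcoact_ract h, rcoact_lact h, rcoact_ract h).

Section Concrete.
Variables (K : sbmc) (H : bialg_data K).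
Hypothesis hH : bialgebra H.
Let mul_t := mul_typ hH.
Let eta_t := eta_typ hH.
Let Delta_t := Delta_typ hH.
Let eps_t := eps_typ hH.

Lemma hbim_unit_hopf : hopf_bimodule H (hbim_unit H).
Proof.
do !split=> /=; try typ;
  rewrite /lcom_mor /rcom_mor; diagram (bialg_rules hH).
Qed.

(** The crossed module axiom is what makes the diagonal right action colinear for the diagonal right
    coaction; it is oriented so as to eliminate a coaction that follows an action. *)
Lemma hbim_ltimes_hopf B : right_crossed_bialgebra H B -> hopf_bimodule H (hbim_ltimes H B).
Proof.
move=> hB; rcb_types hB.
do !split=> /=; try typ; rewrite /lcom_mor /rcom_mor.
all: by diagram (bialg_rules hH, rcb_actA hB, rcb_act1 hB, rcb_coactA hB, rcb_coact1 hB,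
  esym (rcb_crossed hB)).
Qed.

Lemma hbim_rtimes_hopf C : left_crossed_bialgebra H C -> hopf_bimodule H (hbim_rtimes H C).
Proof.
move=> hC; lcb_types hC.
do !split=> /=; try typ; rewrite /lcom_mor /rcom_mor.
all: by diagram (bialg_rules_l hH, lcb_actA hC, lcb_act1 hC, lcb_coactA hC, lcb_coact1 hC,
  esym (lcb_crossed hC)).
Qed.
End Concrete.

(** * Tensor products of Hopf bimodules *)

Section HopfBimodules.
Variables (K : sbmc) (H : bialg_data K) (S : mor K).
Hypothesis hopfH : hopf_algebra H S.
Let hH : bialgebra H. Proof. by case: hopfH. Qed.
Let mul_t := mul_typ hH.
Let eta_t := eta_typ hH.
Let Delta_t := Delta_typ hH.
Let eps_t := eps_typ hH.
Let S_t : S ::: H ~> H. Proof. by case: hopfH. Qed.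
Let SH : mul H ∘ (S ⊗ idm H) ∘ Delta H = eta H ∘ eps H. Proof. by case: hopfH. Qed.
Let HS : mul H ∘ (idm H ⊗ S) ∘ Delta H = eta H ∘ eps H. Proof. by case: hopfH. Qed.

(** * The projection onto coinvariants *)

Section Coinvariants.
Variable X : hbim_data K.
Hypothesis hX : hopf_bimodule H X.

(** The map x |-> x_0 S(x_1), the projection of a right Hopf module onto its coinvariants. *)
Definition coinv : mor K := ract X ∘ (idm X ⊗ S) ∘ rcoact X.

Lemma coinv_typ : coinv ::: X ~> X.
Proof. by have [tr trc] := (ract_typ hX, rcoact_typ hX); rewrite /coinv; typ. Qed.

(** The identity x_0 S(x_1) x_2 = x, one half of the structure theorem of Hopf modules. *)
Lemma coinvK : ract X ∘ (coinv ⊗ idm H) ∘ rcoact X = idm X.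
Proof.
have [tr trc] := (ract_typ hX, rcoact_typ hX).
rewrite /coinv; diagram (rcoactA hX, ractA hX, SH, HS, ract1 hX, rcoact1 hX).
Qed.

(* With [m] and [S m] convolution inverse on [H ⊠ H], both sides agree after
   convolution with [m]; the intermediate term is
   [x ⊗ h |-> coinv(x_0) (x_1 h_1) S(x_2 h_2)]. *)
Lemma coinv_ract : coinv ∘ ract X = coinv ⊗ eps H.
Proof.
have [tr trc] := (ract_typ hX, rcoact_typ hX); have tc := coinv_typ; have E := coinvK.
transitivity (ract X ∘ (ract X ⊗ S) ∘ (coinv ⊗ mul H ⊗ mul H)
  ∘ (idm X ⊗ idm H ⊗ Psi H H ⊗ idm H) ∘ (idm X ⊗ Delta H ⊗ Delta H)
  ∘ (rcoact X ⊗ idm H)).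
  have -> : coinv ∘ ract X = ract X ∘ (ract X ⊗ (S ∘ mul H))
    ∘ (idm X ⊗ Psi H H ⊗ idm H) ∘ (rcoact X ⊗ Delta H).
    by rewrite /coinv; diagram (rcoact_ract hX).
  by diagram (E, esym (rcoactA hX), esym (ractA hX)).
by diagram (esym (Delta_mul hH), HS, eps_mul hH, ractA hX, rcoact1 hX, ract1 hX).
Qed.

(** Dual to [coinv_ract]: now Delta and Delta S are convolution inverse, and the intermediate term
    is x |-> coinv(x_0) (Delta(x_1) Delta(S(x_2))), the first leg of the product acting on
    coinv(x_0). *)
Lemma coinv_rcoact : rcoact X ∘ coinv = coinv ⊗ eta H.
Proof.
have [tr trc] := (ract_typ hX, rcoact_typ hX); have tc := coinv_typ; have E := coinvK.
transitivity ((ract X ⊗ idm H) ∘ (idm X ⊗ mul H ⊗ mul H)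
  ∘ (idm X ⊗ idm H ⊗ Psi H H ⊗ idm H) ∘ (coinv ⊗ Delta H ⊗ Delta H)
  ∘ (rcoact X ⊗ S) ∘ rcoact X).
  have M : rcoact X ∘ coinv = (ract X ⊗ mul H) ∘ (idm X ⊗ Psi H H ⊗ idm H)
    ∘ (rcoact X ⊗ (Delta H ∘ S)) ∘ rcoact X.
    by rewrite /coinv; diagram (rcoact_ract hX).
  by rewrite M; diagram (E, esym (rcoactA hX), esym (ractA hX)).
by diagram (esym (Delta_mul hH), HS, Delta_eta hH, rcoactA hX, rcoact1 hX, ract1 hX).
Qed.

End Coinvariants.

(** * Splittings of the projection and of the injection, and their consequences *)

Section Tensor.
Variable T : rel_tensor H.
Local Notation "X ⊗H Y" := (ht T X Y) (at level 38, left associativity).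

Definition balanced (A D : obj K) (X Y : hbim_data K) (g : mor K) :=
  g ∘ (idm A ⊗ ract X ⊗ idm Y ⊗ idm D) = g ∘ (idm A ⊗ idm X ⊗ lact Y ⊗ idm D).
Definition cobalanced (A D : obj K) (X Y : hbim_data K) (g : mor K) :=
  (idm A ⊗ rcoact X ⊗ idm Y ⊗ idm D) ∘ g = (idm A ⊗ idm X ⊗ lcoact Y ⊗ idm D) ∘ g.

Section Two.
Variables X Y : hbim_data K.
Hypotheses (hX : hopf_bimodule H X) (hY : hopf_bimodule H Y).

Lemma lam_balanced : lam T X Y ∘ (ract X ⊗ idm Y) = lam T X Y ∘ (idm X ⊗ lact Y).
Proof. by case: (lam_coeq T hX hY). Qed.

Lemma rho_cobalanced :
  (rcoact X ⊗ idm Y) ∘ rho T X Y = (idm X ⊗ lcoact Y) ∘ rho T X Y.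
Proof. by case: (rho_eq T hX hY). Qed.

(** The map x ⊗ y |-> coinv(x_0) ⊗ x_1 y is balanced by [coinv_ract], so it factors through the
    coequalizer, and the factor is the section. *)
Lemma lam_split : exists s, [/\ s ::: X ⊗H Y ~> X ⊠ Y, lam T X Y ∘ s = idm (X ⊗H Y) &
  s ∘ lam T X Y = (coinv X ⊗ lact Y) ∘ (rcoact X ⊗ idm Y)].
Proof.
have [tr trc] := (ract_typ hX, rcoact_typ hX); have tc := coinv_typ hX.
have tl := lact_typ hY; have tm := lam_typ T hX hY.
have [dl _ U] := lam_coeq T hX hY.
have [] := U ((coinv X ⊗ lact Y) ∘ (rcoact X ⊗ idm Y)).
- typ.
- diagram (rcoact_ract hX, coinv_ract hX, Delta1l hH, lactA hY).
move=> s [[[ds cs] E] _]; exists s; have ts : s ::: X ⊗H Y ~> X ⊠ Y.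
  by rewrite ds cs; typ.
(* Both [lam ∘ s] and the identity factor [lam] through itself, so uniqueness identifies them. *)
split=> //; have [k0 [_ Uk]] := U (lam T X Y) dl lam_balanced.
transitivity k0.
  apply/esym/Uk; split; first by typ.
  have -> : lam T X Y ∘ s ∘ lam T X Y = lam T X Y ∘ (s ∘ lam T X Y) by diagram.
  by rewrite E; diagram (esym lam_balanced, coinvK hX).
by apply: Uk; split; [typ | diagram].
Qed.

(** Writing y_(-1) ⊗ y_0 for the left coaction of y, the map x ⊗ y |-> coinv(x) y_(-1) ⊗ y_0
    equalizes the two coactions because coinv(x) is coinvariant; its factor through [rho] is the
    retraction. *)
Lemma rho_split : exists q, [/\ q ::: X ⊠ Y ~> X ⊗H Y, q ∘ rho T X Y = idm (X ⊗H Y) &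
  rho T X Y ∘ q = (ract X ⊗ idm Y) ∘ (coinv X ⊗ lcoact Y)].
Proof.
have [tr trc] := (ract_typ hX, rcoact_typ hX); have tc := coinv_typ hX.
have tl := lcoact_typ hY; have tm := rho_typ T hX hY.
have [dl _ U] := rho_eq T hX hY.
have [] := U ((ract X ⊗ idm Y) ∘ (coinv X ⊗ lcoact Y)).
- typ.
- diagram (rcoact_ract hX, coinv_rcoact hX, mul1l hH, lcoactA hY).
move=> s [[[ds cs] E] _]; exists s; have ts : s ::: X ⊠ Y ~> X ⊗H Y.
  by rewrite ds cs; typ.
split=> //; have [k0 [_ Uk]] := U (rho T X Y) dl rho_cobalanced.
transitivity k0.
  apply/esym/Uk; split; first by typ.
  have -> : rho T X Y ∘ (s ∘ rho T X Y) = rho T X Y ∘ s ∘ rho T X Y by diagram.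
  by rewrite E; diagram (esym rho_cobalanced, coinvK hX).
by apply: Uk; split; [typ | diagram].
Qed.

(** The section keeps [lam] an epimorphism between the objects [A] and [D], where the coequalizer
    property alone would say nothing. *)
Lemma lam_epi (A D : obj K) (k k' : mor K) :
  dom k = A ⊠ (X ⊗H Y) ⊠ D -> dom k' = A ⊠ (X ⊗H Y) ⊠ D ->
  k ∘ (idm A ⊗ lam T X Y ⊗ idm D) = k' ∘ (idm A ⊗ lam T X Y ⊗ idm D) -> k = k'.
Proof.
move=> dk dk' E; have [s [ts ls _]] := lam_split; have tm := lam_typ T hX hY.
have tk : k ::: A ⊠ (X ⊗H Y) ⊠ D ~> cod k by [].
have tk' : k' ::: A ⊠ (X ⊗H Y) ⊠ D ~> cod k' by [].
transitivity (k ∘ (idm A ⊗ lam T X Y ⊗ idm D) ∘ (idm A ⊗ s ⊗ idm D)).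
  by diagram ls.
by rewrite E; diagram ls.
Qed.

Lemma rho_mono (A D : obj K) (k k' : mor K) :
  cod k = A ⊠ (X ⊗H Y) ⊠ D -> cod k' = A ⊠ (X ⊗H Y) ⊠ D ->
  (idm A ⊗ rho T X Y ⊗ idm D) ∘ k = (idm A ⊗ rho T X Y ⊗ idm D) ∘ k' -> k = k'.
Proof.
move=> dk dk' E; have [s [ts ls _]] := rho_split; have tm := rho_typ T hX hY.
have tk : k ::: dom k ~> A ⊠ (X ⊗H Y) ⊠ D by [].
have tk' : k' ::: dom k' ~> A ⊠ (X ⊗H Y) ⊠ D by [].
transitivity ((idm A ⊗ s ⊗ idm D) ∘ ((idm A ⊗ rho T X Y ⊗ idm D) ∘ k)).
  by diagram ls.
by rewrite E; diagram ls.
Qed.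

(** Composing [g] with the section works: being balanced gives g(coinv(x_0) ⊗ x_1 y) = g(coinv(x_0)
    x_1 ⊗ y) = g(x ⊗ y). *)
Lemma lam_lift (A D V : obj K) (g : mor K) :
  g ::: A ⊠ X ⊠ Y ⊠ D ~> V -> balanced A D X Y g ->
  exists k, k ::: A ⊠ (X ⊗H Y) ⊠ D ~> V /\ k ∘ (idm A ⊗ lam T X Y ⊗ idm D) = g.
Proof.
rewrite /balanced => tg E; have [s [ts _ sl]] := lam_split.
have tm := lam_typ T hX hY; have tl := lact_typ hY; have tc := coinv_typ hX.
have [tr trc] := (ract_typ hX, rcoact_typ hX).
exists (g ∘ (idm A ⊗ s ⊗ idm D)); split; first by typ.
by diagram (sl, esym E, coinvK hX).
Qed.

Lemma rho_lift (A D V : obj K) (g : mor K) :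
  g ::: V ~> A ⊠ X ⊠ Y ⊠ D -> cobalanced A D X Y g ->
  exists k, k ::: V ~> A ⊠ (X ⊗H Y) ⊠ D /\ (idm A ⊗ rho T X Y ⊗ idm D) ∘ k = g.
Proof.
rewrite /cobalanced => tg E; have [s [ts _ sl]] := rho_split.
have tm := rho_typ T hX hY; have tl := lcoact_typ hY; have tc := coinv_typ hX.
have [tr trc] := (ract_typ hX, rcoact_typ hX).
exists ((idm A ⊗ s ⊗ idm D) ∘ g); split; first by typ.
by diagram (sl, esym E, coinvK hX).
Qed.

Lemma lam_epi0 (k k' : mor K) : dom k = X ⊗H Y -> dom k' = X ⊗H Y ->
  k ∘ lam T X Y = k' ∘ lam T X Y -> k = k'.
Proof.
by move=> dk dk' E; apply: (lam_epi (A := tun) (D := tun)); rewrite ?tob1l ?tob1r ?tmor1l ?tmor1r.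
Qed.

Lemma rho_mono0 (k k' : mor K) : cod k = X ⊗H Y -> cod k' = X ⊗H Y ->
  rho T X Y ∘ k = rho T X Y ∘ k' -> k = k'.
Proof.
by move=> dk dk' E; apply: (rho_mono (A := tun) (D := tun)); rewrite ?tob1l ?tob1r ?tmor1l ?tmor1r.
Qed.

Lemma lam_lift0 (V : obj K) (g : mor K) : g ::: X ⊠ Y ~> V ->
  g ∘ (ract X ⊗ idm Y) = g ∘ (idm X ⊗ lact Y) ->
  exists k, k ::: X ⊗H Y ~> V /\ k ∘ lam T X Y = g.
Proof.
move=> tg E; have [] := lam_lift (A := tun) (D := tun) (V := V) (g := g).
- by rewrite tob1l tob1r.
- by rewrite /balanced !tmor1r -!tmorA !tmor1l.
by move=> k; rewrite tob1l tob1r tmor1l tmor1r; exists k.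
Qed.

Lemma rho_lift0 (V : obj K) (g : mor K) : g ::: V ~> X ⊠ Y ->
  (rcoact X ⊗ idm Y) ∘ g = (idm X ⊗ lcoact Y) ∘ g ->
  exists k, k ::: V ~> X ⊗H Y /\ rho T X Y ∘ k = g.
Proof.
move=> tg E; have [] := rho_lift (A := tun) (D := tun) (V := V) (g := g).
- by rewrite tob1l tob1r.
- by rewrite /cobalanced !tmor1r -!tmorA !tmor1l.
by move=> k; rewrite tob1l tob1r tmor1l tmor1r; exists k.
Qed.

Lemma lact_lam : lact (X ⊗H Y) ∘ (idm H ⊗ lam T X Y) = lam T X Y ∘ (lact X ⊗ idm Y).
Proof. by have [E _] := lam_bimod T hX hY; rewrite -E. Qed.
Lemma ract_lam : ract (X ⊗H Y) ∘ (lam T X Y ⊗ idm H) = lam T X Y ∘ (idm X ⊗ ract Y).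
Proof. by have [_ E] := lam_bimod T hX hY; rewrite -E. Qed.
Lemma rho_lcoact : (idm H ⊗ rho T X Y) ∘ lcoact (X ⊗H Y) = (lcoact X ⊗ idm Y) ∘ rho T X Y.
Proof. by have [E _] := rho_bicom T hX hY; rewrite -E. Qed.
Lemma rho_rcoact : (rho T X Y ⊗ idm H) ∘ rcoact (X ⊗H Y) = (idm X ⊗ rcoact Y) ∘ rho T X Y.
Proof. by have [_ E] := rho_bicom T hX hY; rewrite -E. Qed.

(** The record [rel_tensor] relates [lam] to actions and [rho] to coactions. The four mixed
    compatibilities starting here follow by testing against the monomorphism [rho] or the
    epimorphism [lam], where [rho_lam] makes everything explicit. *)
Lemma lcoact_lam : lcoact (X ⊗H Y) ∘ lam T X Y
  = (idm H ⊗ lam T X Y) ∘ lcoact_tens H X Y (lcoact X) (lcoact Y).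
Proof.
have hXY := ht_hopf T hX hY; types hX; types hY; types hXY.
have tl := lam_typ T hX hY; have tr := rho_typ T hX hY.
rewrite /lcoact_tens; apply: (rho_mono (A := H) (D := tun)); [typ | typ |].
by diagram (rho_lcoact, rho_lam T hX hY, bialg_rules hH, nf hX, nf hY).
Qed.

Lemma rcoact_lam : rcoact (X ⊗H Y) ∘ lam T X Y
  = (lam T X Y ⊗ idm H) ∘ rcoact_tens H X Y (rcoact X) (rcoact Y).
Proof.
have hXY := ht_hopf T hX hY; types hX; types hY; types hXY.
have tl := lam_typ T hX hY; have tr := rho_typ T hX hY.
rewrite /rcoact_tens; apply: (rho_mono (A := tun) (D := H)); [typ | typ |].
by diagram (rho_rcoact, rho_lam T hX hY, bialg_rules hH, nf hX, nf hY).
Qed.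

Lemma rho_lact : rho T X Y ∘ lact (X ⊗H Y)
  = lact_tens H X Y (lact X) (lact Y) ∘ (idm H ⊗ rho T X Y).
Proof.
have hXY := ht_hopf T hX hY; types hX; types hY; types hXY.
have tl := lam_typ T hX hY; have tr := rho_typ T hX hY.
rewrite /lact_tens; apply: (lam_epi (A := H) (D := tun)); [typ | typ |].
by diagram (lact_lam, rho_lam T hX hY, bialg_rules hH, nf hX, nf hY).
Qed.

Lemma rho_ract : rho T X Y ∘ ract (X ⊗H Y)
  = ract_tens H X Y (ract X) (ract Y) ∘ (rho T X Y ⊗ idm H).
Proof.
have hXY := ht_hopf T hX hY; types hX; types hY; types hXY.
have tl := lam_typ T hX hY; have tr := rho_typ T hX hY.
rewrite /ract_tens; apply: (lam_epi (A := tun) (D := H)); [typ | typ |].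
by diagram (ract_lam, rho_lam T hX hY, bialg_rules hH, nf hX, nf hY).
Qed.
End Two.

(** * Functoriality of the tensor product over H *)

Section Hmap.
Variables X Y X' Y' : hbim_data K.
Hypotheses (hX : hopf_bimodule H X) (hY : hopf_bimodule H Y).
Hypotheses (hX' : hopf_bimodule H X') (hY' : hopf_bimodule H Y').
Variables f g : mor K.
Hypotheses (tf : f ::: X ~> X') (tg : g ::: Y ~> Y').
Hypothesis f_rmod : rmod_mor H (ract X) (ract X') f.
Hypothesis g_lmod : lmod_mor H (lact Y) (lact Y') g.
Let f_mod : f ∘ ract X = ract X' ∘ (f ⊗ idm H) := f_rmod.
Let g_mod : g ∘ lact Y = lact Y' ∘ (idm H ⊗ g) := g_lmod.

Lemma hmap_lam : hmap T X Y X' Y' f g ::: X ⊗H Y ~> X' ⊗H Y' /\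
  hmap T X Y X' Y' f g ∘ lam T X Y = lam T X' Y' ∘ (f ⊗ g).
Proof.
the_intro; types hX; types hY; types hX'; types hY'.
have tl := lam_typ T hX hY; have tl' := lam_typ T hX' hY'.
apply: (lam_lift0 hX hY); first by typ.
by diagram (f_mod, g_mod, lam_balanced hX' hY').
Qed.

(** While [hmap] is defined through [lam], coproducts are read through [rho]; colinearity on the
    inner sides lets [f ⊗ g] pass through the explicit form of [rho ∘ lam]. *)
Lemma hmap_rho : rcom_mor H (rcoact X) (rcoact X') f -> lcom_mor H (lcoact Y) (lcoact Y') g ->
  rho T X' Y' ∘ hmap T X Y X' Y' f g = (f ⊗ g) ∘ rho T X Y.
Proof.
rewrite /rcom_mor /lcom_mor => f_com g_com.
have [th E] := hmap_lam; types hX; types hY; types hX'; types hY'.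
have tl := lam_typ T hX hY; have tl' := lam_typ T hX' hY'.
have tr := rho_typ T hX hY; have tr' := rho_typ T hX' hY'.
apply: (lam_epi0 hX hY); [typ | typ |].
by diagram (E, rho_lam T hX hY, rho_lam T hX' hY', f_com, g_com, esym f_mod, esym g_mod).
Qed.

Lemma hmap_lmod : lmod_mor H (lact X) (lact X') f ->
  lmod_mor H (lact (X ⊗H Y)) (lact (X' ⊗H Y')) (hmap T X Y X' Y' f g).
Proof.
rewrite /lmod_mor => fl.
have [th E] := hmap_lam; types hX; types hX'.
have hXY := ht_hopf T hX hY; have hXY' := ht_hopf T hX' hY'; types hXY; types hXY'.
have tl := lam_typ T hX hY; have tl' := lam_typ T hX' hY'.
apply: (lam_epi hX hY (A := H) (D := tun)); [typ | typ |].
by diagram (E, lact_lam hX hY, lact_lam hX' hY', fl).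
Qed.

Lemma hmap_lcom : rcom_mor H (rcoact X) (rcoact X') f -> lcom_mor H (lcoact Y) (lcoact Y') g ->
  lcom_mor H (lcoact X) (lcoact X') f ->
  lcom_mor H (lcoact (X ⊗H Y)) (lcoact (X' ⊗H Y')) (hmap T X Y X' Y' f g).
Proof.
move=> f_com g_com; rewrite /lcom_mor => fl; have E' := hmap_rho f_com g_com.
have [th _] := hmap_lam; types hX; types hX'.
have hXY := ht_hopf T hX hY; have hXY' := ht_hopf T hX' hY'; types hXY; types hXY'.
have tl := rho_typ T hX hY; have tl' := rho_typ T hX' hY'.
apply: (rho_mono hX' hY' (A := H) (D := tun)); [typ | typ |].
by diagram (E', rho_lcoact hX hY, rho_lcoact hX' hY', fl).
Qed.
End Hmap.

(** * The associativity constraint and its inverse *)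

Section Hassoc.
Variables X Y Z : hbim_data K.
Hypotheses (hX : hopf_bimodule H X) (hY : hopf_bimodule H Y) (hZ : hopf_bimodule H Z).
Let hXY := ht_hopf T hX hY.
Let hYZ := ht_hopf T hY hZ.
Let tlXY := lam_typ T hX hY.
Let tlYZ := lam_typ T hY hZ.
Let tl1 := lam_typ T hXY hZ.
Let tl2 := lam_typ T hX hYZ.
Let trXY := rho_typ T hX hY.
Let trYZ := rho_typ T hY hZ.
Let tr1 := rho_typ T hXY hZ.
Let tr2 := rho_typ T hX hYZ.

Lemma hassoc_lam : hassoc T X Y Z ::: (X ⊗H Y) ⊗H Z ~> X ⊗H (Y ⊗H Z) /\
  hassoc T X Y Z ∘ lam T (X ⊗H Y) Z ∘ (lam T X Y ⊗ idm Z)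
    = lam T X (Y ⊗H Z) ∘ (idm X ⊗ lam T Y Z).
Proof.
the_intro; types hX; types hY; types hZ; types hXY; types hYZ.
(* The descent has two stages: first over the middle H between X and Y, then over the one before
   Z. *)
have [] := @lam_lift _ _ hX hY tun Z (X ⊗H (Y ⊗H Z))
  (lam T X (Y ⊗H Z) ∘ (idm X ⊗ lam T Y Z)).
- by typ.
- rewrite /balanced; diagram (lam_balanced hX hYZ, lact_lam hY hZ).
move=> k; rewrite tob1l tmor1l => -[tk kE].
have [] := lam_lift0 hXY hZ tk.
  apply: (lam_epi hX hY (A := tun) (D := H ⊠ Z)); [typ | typ |].
  by diagram (kE, ract_lam hX hY, lam_balanced hY hZ).
by move=> h [th hE]; exists h; split=> //; rewrite hE kE.
Qed.

Lemma hassocV_lam : hassocV T X Y Z ::: X ⊗H (Y ⊗H Z) ~> (X ⊗H Y) ⊗H Z /\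
  hassocV T X Y Z ∘ lam T X (Y ⊗H Z) ∘ (idm X ⊗ lam T Y Z)
    = lam T (X ⊗H Y) Z ∘ (lam T X Y ⊗ idm Z).
Proof.
the_intro; types hX; types hY; types hZ; types hXY; types hYZ.
have [] := @lam_lift _ _ hY hZ X tun ((X ⊗H Y) ⊗H Z)
  (lam T (X ⊗H Y) Z ∘ (lam T X Y ⊗ idm Z)).
- by typ.
- rewrite /balanced; diagram (esym (lam_balanced hXY hZ), ract_lam hX hY).
move=> k; rewrite tob1r tmor1r => -[tk kE].
have [] := lam_lift0 hX hYZ tk.
  apply: (lam_epi hY hZ (A := X ⊠ H) (D := tun)); [typ | typ |].
  by diagram (kE, lact_lam hY hZ, lam_balanced hX hY).
by move=> h [th hE]; exists h; split=> //; rewrite hE kE.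
Qed.

Lemma hassoc_epi (k k' : mor K) : dom k = (X ⊗H Y) ⊗H Z -> dom k' = (X ⊗H Y) ⊗H Z ->
  k ∘ lam T (X ⊗H Y) Z ∘ (lam T X Y ⊗ idm Z)
  = k' ∘ lam T (X ⊗H Y) Z ∘ (lam T X Y ⊗ idm Z) -> k = k'.
Proof.
move=> dk dk' E; have tk : k ::: (X ⊗H Y) ⊗H Z ~> cod k by [].
have tk' : k' ::: (X ⊗H Y) ⊗H Z ~> cod k' by [].
apply: (lam_epi0 hXY hZ) => //; apply: (lam_epi hX hY (A := tun) (D := Z)); [typ | typ |].
by rewrite tmor1l.
Qed.

(** The associator of the tensor products is also that of the cotensor products: pulled back to
    [X ⊠ Y ⊠ Z], both sides become the same expression in actions and coactions. *)
Lemma hassoc_rho : (idm X ⊗ rho T Y Z) ∘ rho T X (Y ⊗H Z) ∘ hassoc T X Y Z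
  = (rho T X Y ⊗ idm Z) ∘ rho T (X ⊗H Y) Z.
Proof.
have [th E] := hassoc_lam; types hX; types hY; types hZ; types hXY; types hYZ.
apply: hassoc_epi; [typ | typ |].
by diagram (E, rho_lam T hXY hZ, rho_lam T hX hYZ, rho_lam T hX hY, rho_lam T hY hZ,
  lcoact_lam hY hZ, rcoact_lam hX hY, rho_lact hY hZ, rho_ract hX hY, bialg_rules hH,
  nf hX, nf hY, nf hZ).
Qed.

Lemma hassocV_epi (k k' : mor K) : dom k = X ⊗H (Y ⊗H Z) -> dom k' = X ⊗H (Y ⊗H Z) ->
  k ∘ lam T X (Y ⊗H Z) ∘ (idm X ⊗ lam T Y Z)
  = k' ∘ lam T X (Y ⊗H Z) ∘ (idm X ⊗ lam T Y Z) -> k = k'.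
Proof.
move=> dk dk' E; have tk : k ::: X ⊗H (Y ⊗H Z) ~> cod k by [].
have tk' : k' ::: X ⊗H (Y ⊗H Z) ~> cod k' by [].
apply: (lam_epi0 hX hYZ) => //; apply: (lam_epi hY hZ (A := X) (D := tun)); [typ | typ |].
by rewrite tmor1r.
Qed.

Lemma hassocV_rho : (rho T X Y ⊗ idm Z) ∘ rho T (X ⊗H Y) Z ∘ hassocV T X Y Z
  = (idm X ⊗ rho T Y Z) ∘ rho T X (Y ⊗H Z).
Proof.
have [th E] := hassocV_lam; types hX; types hY; types hZ; types hXY; types hYZ.
apply: hassocV_epi; [typ | typ |].
by diagram (E, rho_lam T hXY hZ, rho_lam T hX hYZ, rho_lam T hX hY, rho_lam T hY hZ,
  lcoact_lam hY hZ, rcoact_lam hX hY, rho_lact hY hZ, rho_ract hX hY, bialg_rules hH,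
  nf hX, nf hY, nf hZ).
Qed.

Lemma hassoc_lmod :
  lmod_mor H (lact ((X ⊗H Y) ⊗H Z)) (lact (X ⊗H (Y ⊗H Z))) (hassoc T X Y Z).
Proof.
have h1 := ht_hopf T hXY hZ; have h2 := ht_hopf T hX hYZ.
have [th E] := hassoc_lam; types hX; types hXY; types h1; types h2.
apply: (lam_epi hXY hZ (A := H) (D := tun)); [typ | typ |].
apply: (lam_epi hX hY (A := H) (D := Z)); [typ | typ |].
by diagram (E, lact_lam hXY hZ, lact_lam hX hY, lact_lam hX hYZ).
Qed.

Lemma hassocV_lmod :
  lmod_mor H (lact (X ⊗H (Y ⊗H Z))) (lact ((X ⊗H Y) ⊗H Z)) (hassocV T X Y Z).
Proof.
have h1 := ht_hopf T hXY hZ; have h2 := ht_hopf T hX hYZ.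
have [th E] := hassocV_lam; types hX; types hXY; types h1; types h2.
apply: (lam_epi hX hYZ (A := H) (D := tun)); [typ | typ |].
apply: (lam_epi hY hZ (A := H ⊠ X) (D := tun)); [typ | typ |].
by diagram (E, lact_lam hXY hZ, lact_lam hX hY, lact_lam hX hYZ).
Qed.

Lemma hassoc_lcom :
  lcom_mor H (lcoact ((X ⊗H Y) ⊗H Z)) (lcoact (X ⊗H (Y ⊗H Z))) (hassoc T X Y Z).
Proof.
have h1 := ht_hopf T hXY hZ; have h2 := ht_hopf T hX hYZ.
have [th _] := hassoc_lam; have E := hassoc_rho; types hX; types hXY; types h1; types h2.
apply: (rho_mono hX hYZ (A := H) (D := tun)); [typ | typ |].
apply: (rho_mono hY hZ (A := H ⊠ X) (D := tun)); [typ | typ |].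
by diagram (E, rho_lcoact hXY hZ, rho_lcoact hX hY, rho_lcoact hX hYZ).
Qed.

Lemma hassocV_lcom :
  lcom_mor H (lcoact (X ⊗H (Y ⊗H Z))) (lcoact ((X ⊗H Y) ⊗H Z)) (hassocV T X Y Z).
Proof.
have h1 := ht_hopf T hXY hZ; have h2 := ht_hopf T hX hYZ.
have [th _] := hassocV_lam; have E := hassocV_rho; types hX; types hXY; types h1; types h2.
apply: (rho_mono hXY hZ (A := H) (D := tun)); [typ | typ |].
apply: (rho_mono hX hY (A := H) (D := Z)); [typ | typ |].
by diagram (E, rho_lcoact hXY hZ, rho_lcoact hX hY, rho_lcoact hX hYZ).
Qed.
End Hassoc.

(** * The braiding of Hopf bimodules and its linearity and colinearity *)

Section Hbraid.
Variables X Y : hbim_data K.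
Hypotheses (hX : hopf_bimodule H X) (hY : hopf_bimodule H Y).
Let hXY := ht_hopf T hX hY.
Let hYX := ht_hopf T hY hX.
Let tlXY := lam_typ T hX hY.
Let tlYX := lam_typ T hY hX.
Let trXY := rho_typ T hX hY.
Let trYX := rho_typ T hY hX.

Lemma hbraid_spec : hbraid T X Y ::: X ⊗H Y ~> Y ⊗H X /\
  rho T Y X ∘ hbraid T X Y ∘ lam T X Y
    = (lact Y ⊗ ract X) ∘ (idm H ⊗ Psi X Y ⊗ idm H) ∘ (lcoact X ⊗ rcoact Y).
Proof.
the_intro; types hX; types hY; types hXY; types hYX.
have [] := @lam_lift0 _ _ hX hY (Y ⊠ X)
  ((lact Y ⊗ ract X) ∘ (idm H ⊗ Psi X Y ⊗ idm H) ∘ (lcoact X ⊗ rcoact Y)).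
- by typ.
- diagram (nf hX, nf hY, bialg_rules hH).
(* The formula has descended along [lam]; the factor [k] still has to be lifted along [rho], and its
   cobalancedness is tested on [X ⊠ Y]. *)
move=> k [tk kE]; have [] := rho_lift0 hY hX tk.
  apply: (lam_epi0 hX hY); [typ | typ |].
  diagram (kE, nf hX, nf hY, bialg_rules hH).
by move=> h [th hE]; exists h; split=> //; rewrite hE kE.
Qed.

Lemma hbraid_lmod : lmod_mor H (lact (X ⊗H Y)) (lact (Y ⊗H X)) (hbraid T X Y).
Proof.
have [th E] := hbraid_spec; types hX; types hY; types hXY; types hYX.
rewrite /lmod_mor; apply: (rho_mono0 hY hX); [typ | typ |].
apply: (lam_epi hX hY (A := H) (D := tun)); [typ | typ |].
by diagram (lact_lam hX hY, rho_lact hY hX, E, bialg_rules hH, nf hX, nf hY).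
Qed.

Lemma hbraid_rmod : rmod_mor H (ract (X ⊗H Y)) (ract (Y ⊗H X)) (hbraid T X Y).
Proof.
have [th E] := hbraid_spec; types hX; types hY; types hXY; types hYX.
rewrite /rmod_mor; apply: (rho_mono0 hY hX); [typ | typ |].
apply: (lam_epi hX hY (A := tun) (D := H)); [typ | typ |].
by diagram (ract_lam hX hY, rho_ract hY hX, E, bialg_rules hH, nf hX, nf hY).
Qed.

Lemma hbraid_lcom : lcom_mor H (lcoact (X ⊗H Y)) (lcoact (Y ⊗H X)) (hbraid T X Y).
Proof.
have [th E] := hbraid_spec; types hX; types hY; types hXY; types hYX.
rewrite /lcom_mor; apply: (lam_epi0 hX hY); [typ | typ |].
apply: (rho_mono hY hX (A := H) (D := tun)); [typ | typ |].
by diagram (rho_lcoact hY hX, lcoact_lam hX hY, E, bialg_rules hH, nf hX, nf hY).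
Qed.

Lemma hbraid_rcom : rcom_mor H (rcoact (X ⊗H Y)) (rcoact (Y ⊗H X)) (hbraid T X Y).
Proof.
have [th E] := hbraid_spec; types hX; types hY; types hXY; types hYX.
rewrite /rcom_mor; apply: (lam_epi0 hX hY); [typ | typ |].
apply: (rho_mono hY hX (A := tun) (D := H)); [typ | typ |].
by diagram (rho_rcoact hY hX, rcoact_lam hX hY, E, bialg_rules hH, nf hX, nf hY).
Qed.
End Hbraid.

(** * The unit constraint *)

Let hU : hopf_bimodule H (hbim_unit H) := hbim_unit_hopf hH.

Lemma hunit_lam : hunit T ::: hbim_unit H ⊗H hbim_unit H ~> H /\
  hunit T ∘ lam T (hbim_unit H) (hbim_unit H) = mul H.
Proof. by the_intro; apply: (lam_lift0 hU hU) => //; exact: mulA hH. Qed.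

Lemma hunitV_rho : hunitV T ::: H ~> hbim_unit H ⊗H hbim_unit H /\
  rho T (hbim_unit H) (hbim_unit H) ∘ hunitV T = Delta H.
Proof. by the_intro; apply: (rho_lift0 hU hU) => //; exact: DeltaA hH. Qed.

(** Expresses through [lam] a morphism that is specified through [rho], so that it can be composed
    with [hmap]. *)
Lemma hunitV_mul : hunitV T ∘ mul H = lam T (hbim_unit H) (hbim_unit H).
Proof.
have [tv E] := hunitV_rho; have tl := lam_typ T hU hU; have tr := rho_typ T hU hU.
apply: (rho_mono0 hU hU); [typ | typ |].
by diagram (E, rho_lam T hU hU, bialg_rules hH).
Qed.

(** * Structure maps of a tensor product of bialgebras in Hopf bimodules *)

Section TensorBialgebra.
Variables A D : hbialg_data K.
Hypotheses (hA : hopf_bimodule H A) (hD : hopf_bimodule H D).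
Let hAD := ht_hopf T hA hD.
Let hDA := ht_hopf T hD hA.
Let hAA := ht_hopf T hA hA.
Let hDD := ht_hopf T hD hD.
Let hD_AD := ht_hopf T hD hAD.
Let hDA_D := ht_hopf T hDA hD.
Let hAD_D := ht_hopf T hAD hD.
Let hA_DD := ht_hopf T hA hDD.

Let rmod_id (X : hbim_data K) : hopf_bimodule H X -> rmod_mor H (ract X) (ract X) (idm X).
Proof. by move=> hX; types hX; rewrite /rmod_mor; diagram. Qed.
Let lmod_id (X : hbim_data K) : hopf_bimodule H X -> lmod_mor H (lact X) (lact X) (idm X).
Proof. by move=> hX; types hX; rewrite /lmod_mor; diagram. Qed.
Let rcom_id (X : hbim_data K) : hopf_bimodule H X -> rcom_mor H (rcoact X) (rcoact X) (idm X).
Proof. by move=> hX; types hX; rewrite /rcom_mor; diagram. Qed.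
Let lcom_id (X : hbim_data K) : hopf_bimodule H X -> lcom_mor H (lcoact X) (lcoact X) (idm X).
Proof. by move=> hX; types hX; rewrite /lcom_mor; diagram. Qed.
Let typ_id (X : obj K) : idm X ::: X ~> X. Proof. by rewrite dom_idm cod_idm. Qed.

Section Product.
Hypotheses (tmA : hmul A ::: A ⊗H A ~> A) (tmD : hmul D ::: D ⊗H D ~> D).
Hypothesis mA_rmod : rmod_mor H (ract (A ⊗H A)) (ract A) (hmul A).
Hypothesis mD_lmod : lmod_mor H (lact (D ⊗H D)) (lact D) (hmul D).
Variable t : mor K.
Hypotheses (t_typ : t ::: D ⊠ A ~> A ⊠ D).
Hypothesis tE : hbraid T D A ∘ lam T D A = lam T A D ∘ t.

(** Any lift [t] of the braiding to plain tensor products will do: above [lam], the associators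
    disappear and the product has the form of an ordinary tensor product of algebras with [t] as its
    exchange. *)
Lemma hb_tensor_mul :
  hmul (hb_tensor T A D) ::: (A ⊗H D) ⊗H (A ⊗H D) ~> A ⊗H D /\
  hmul (hb_tensor T A D) ∘ lam T (A ⊗H D) (A ⊗H D) ∘ (lam T A D ⊗ lam T A D)
  = lam T A D ∘ ((hmul A ∘ lam T A A) ⊗ (hmul D ∘ lam T D D)) ∘ (idm A ⊗ t ⊗ idm D).
Proof.
have [tb _] := hbraid_spec hD hA.
have [tf fE] := hmap_lam hDA hD hAD hD tb (typ_id D) (hbraid_rmod hD hA) (lmod_id hD).
have fl := hmap_lmod hDA hD hAD hD tb (typ_id D) (hbraid_rmod hD hA) (lmod_id hD)
  (hbraid_lmod hD hA).
have [ta1 a1E] := hassoc_lam hA hD hAD; have [ta2 a2E] := hassocV_lam hD hA hD.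
have [ta3 a3E] := hassoc_lam hA hD hD; have [ta4 a4E] := hassocV_lam hA hA hDD.
set g := hassoc T A D D ∘ hmap T (D ⊗H A) D (A ⊗H D) D (hbraid T D A) (idm D)
  ∘ hassocV T D A D.
have tg : g ::: D ⊗H (A ⊗H D) ~> A ⊗H (D ⊗H D) by rewrite /g; typ.
have gl : lmod_mor H (lact (D ⊗H (A ⊗H D))) (lact (A ⊗H (D ⊗H D))) g.
  have := (hassoc_lmod hA hD hD, hassocV_lmod hD hA hD, fl).
  rewrite /lmod_mor /g => -[[E1 E2] E3].
  types hD_AD; types hA_DD; types hDA_D; types hAD_D.
  by diagram (E1, E2, E3).
have [tG GE] := hmap_lam hA hD_AD hA hA_DD (typ_id A) tg (rmod_id hA) gl.
have [tM ME] := hmap_lam hAA hDD hA hD tmA tmD mA_rmod mD_lmod.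
have tAD := lam_typ T hA hD; have tDA := lam_typ T hD hA.
have tAA := lam_typ T hA hA; have tDD := lam_typ T hD hD.
have := (lam_typ T hAD hAD, lam_typ T hA hD_AD, lam_typ T hA hA_DD, lam_typ T hAA hDD,
  lam_typ T hD hAD, lam_typ T hDA hD, lam_typ T hAD hD, lam_typ T hA hDD).
move=> [[[[[[[? ?] ?] ?] ?] ?] ?] ?].
rewrite /= /hmiddle -/g; split; first by typ.
have gE : g ∘ lam T D (A ⊗H D) ∘ (idm D ⊗ lam T A D)
  = lam T A (D ⊗H D) ∘ (idm A ⊗ lam T D D) ∘ (t ⊗ idm D).
  by rewrite /g; diagram (a2E, fE, tE, a3E).
by diagram (a1E, GE, gE, a4E, ME).
Qed.
End Product.

Section Coproduct.
Hypotheses (tDA : hDelta A ::: A ~> A ⊗H A) (tDD : hDelta D ::: D ~> D ⊗H D).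
Hypothesis DA_rmod : rmod_mor H (ract A) (ract (A ⊗H A)) (hDelta A).
Hypothesis DD_lmod : lmod_mor H (lact D) (lact (D ⊗H D)) (hDelta D).
Hypothesis DA_rcom : rcom_mor H (rcoact A) (rcoact (A ⊗H A)) (hDelta A).
Hypothesis DD_lcom : lcom_mor H (lcoact D) (lcoact (D ⊗H D)) (hDelta D).
Variable t : mor K.
Hypotheses (t_typ : t ::: A ⊠ D ~> D ⊠ A).
Hypothesis tE : rho T D A ∘ hbraid T A D = t ∘ rho T A D.

(** The dual of [hb_tensor_mul], read below [rho]; every factor now needs its description through
    [rho], hence the additional colinearity hypotheses. *)
Lemma hb_tensor_Delta :
  hDelta (hb_tensor T A D) ::: A ⊗H D ~> (A ⊗H D) ⊗H (A ⊗H D) /\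
  (rho T A D ⊗ rho T A D) ∘ (rho T (A ⊗H D) (A ⊗H D) ∘ hDelta (hb_tensor T A D))
  = (idm A ⊗ t ⊗ idm D) ∘ ((rho T A A ∘ hDelta A) ⊗ (rho T D D ∘ hDelta D))
    ∘ rho T A D.
Proof.
have [tb _] := hbraid_spec hA hD.
have [tf _] := hmap_lam hAD hD hDA hD tb (typ_id D) (hbraid_rmod hA hD) (lmod_id hD).
have fE := hmap_rho hAD hD hDA hD tb (typ_id D) (hbraid_rmod hA hD) (lmod_id hD)
  (hbraid_rcom hA hD) (lcom_id hD).
have fl := hmap_lmod hAD hD hDA hD tb (typ_id D) (hbraid_rmod hA hD) (lmod_id hD)
  (hbraid_lmod hA hD).
have fc := hmap_lcom hAD hD hDA hD tb (typ_id D) (hbraid_rmod hA hD) (lmod_id hD)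
  (hbraid_rcom hA hD) (lcom_id hD) (hbraid_lcom hA hD).
have [ta1 _] := hassoc_lam hA hA hDD; have [ta2 _] := hassocV_lam hA hD hD.
have [ta3 _] := hassoc_lam hD hA hD; have [ta4 _] := hassocV_lam hA hD hAD.
have a1E := hassoc_rho hA hA hDD; have a2E := hassocV_rho hA hD hD.
have a3E := hassoc_rho hD hA hD; have a4E := hassocV_rho hA hD hAD.
set g := hassoc T D A D ∘ hmap T (A ⊗H D) D (D ⊗H A) D (hbraid T A D) (idm D)
  ∘ hassocV T A D D.
have tg : g ::: A ⊗H (D ⊗H D) ~> D ⊗H (A ⊗H D) by rewrite /g; typ.
have gl : lmod_mor H (lact (A ⊗H (D ⊗H D))) (lact (D ⊗H (A ⊗H D))) g.
  have := (hassoc_lmod hD hA hD, hassocV_lmod hA hD hD, fl).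
  rewrite /lmod_mor /g => -[[E1 E2] E3].
  types hD_AD; types hA_DD; types hDA_D; types hAD_D.
  by diagram (E1, E2, E3).
have gc : lcom_mor H (lcoact (A ⊗H (D ⊗H D))) (lcoact (D ⊗H (A ⊗H D))) g.
  have := (hassoc_lcom hD hA hD, hassocV_lcom hA hD hD, fc).
  rewrite /lcom_mor /g => -[[E1 E2] E3].
  types hD_AD; types hA_DD; types hDA_D; types hAD_D.
  by diagram (E1, E2, E3).
have [tG _] := hmap_lam hA hA_DD hA hD_AD (typ_id A) tg (rmod_id hA) gl.
have GE := hmap_rho hA hA_DD hA hD_AD (typ_id A) tg (rmod_id hA) gl (rcom_id hA) gc.
have [tM _] := hmap_lam hA hD hAA hDD tDA tDD DA_rmod DD_lmod.
have ME := hmap_rho hA hD hAA hDD tDA tDD DA_rmod DD_lmod DA_rcom DD_lcom.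
have rAD := rho_typ T hA hD; have rDA := rho_typ T hD hA.
have rAA := rho_typ T hA hA; have rDD := rho_typ T hD hD.
have := (rho_typ T hAD hAD, rho_typ T hA hD_AD, rho_typ T hA hA_DD, rho_typ T hAA hDD,
  rho_typ T hD hAD, rho_typ T hDA hD, rho_typ T hAD hD, rho_typ T hA hDD).
move=> [[[[[[[? ?] ?] ?] ?] ?] ?] ?].
rewrite /= /hmiddle -/g; split; first by typ.
have gE : (idm D ⊗ rho T A D) ∘ rho T D (A ⊗H D) ∘ g
  = (t ⊗ idm D) ∘ (idm A ⊗ rho T D D) ∘ rho T A (D ⊗H D).
  by rewrite /g; diagram (a2E, fE, tE, a3E).
by diagram (a1E, GE, gE, a4E, ME).
Qed.
End Coproduct.

Lemma hb_tensor_eta : heta A ::: H ~> A -> heta D ::: H ~> D ->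
  rmod_mor H (mul H) (ract A) (heta A) -> lmod_mor H (mul H) (lact D) (heta D) ->
  heta (hb_tensor T A D) ∘ eta H = lam T A D ∘ ((heta A ∘ eta H) ⊗ (heta D ∘ eta H)).
Proof.
move=> tA tD lA lD; have [th E] := hmap_lam hU hU hA hD tA tD lA lD.
have [tv _] := hunitV_rho; have Ev := hunitV_mul.
have tl := lam_typ T hU hU; have tAD := lam_typ T hA hD.
(* Writing the unit of H as a product of two units makes [hunitV_mul] applicable. *)
have -> : heta (hb_tensor T A D) ∘ eta H
  = heta (hb_tensor T A D) ∘ (mul H ∘ (eta H ⊗ eta H)) by congr comp; diagram (mul1l hH).
by rewrite /=; diagram (Ev, E).
Qed.

Lemma hb_tensor_eps : heps A ::: A ~> H -> heps D ::: D ~> H ->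
  rmod_mor H (ract A) (mul H) (heps A) -> lmod_mor H (lact D) (mul H) (heps D) ->
  heps (hb_tensor T A D) ::: A ⊗H D ~> H /\
  eps H ∘ heps (hb_tensor T A D) ∘ lam T A D = (eps H ∘ heps A) ⊗ (eps H ∘ heps D).
Proof.
move=> tA tD lA lD; have [th E] := hmap_lam hA hD hU hU tA tD lA lD.
have [tv Ev] := hunit_lam; have tl := lam_typ T hU hU; have tAD := lam_typ T hA hD.
by rewrite /=; split; [typ | diagram (E, Ev, eps_mul hH)].
Qed.
End TensorBialgebra.

End Tensor.
End HopfBimodules.

(** * The structure of Y ⊗_H X *)

Section Proposition.
Variables (K : sbmc) (H : bialg_data K) (S : mor K).
Hypothesis hopfH : hopf_algebra H S.
Let hH : bialgebra H. Proof. by case: hopfH. Qed.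
Variables (B C : xbialg_data K).
Hypotheses (hB : right_crossed_bialgebra H B) (hC : left_crossed_bialgebra H C).
Variable T : rel_tensor H.
Let mul_t := mul_typ hH.
Let eta_t := eta_typ hH.
Let Delta_t := Delta_typ hH.
Let eps_t := eps_typ hH.

Local Notation X := (hbim_ltimes H B).
Local Notation Y := (hbim_rtimes H C).
Let hX : hopf_bimodule H X := hbim_ltimes_hopf hH hB.
Let hY : hopf_bimodule H Y := hbim_rtimes_hopf hH hC.
Let hXX := ht_hopf T hX hX.
Let hYY := ht_hopf T hY hY.
Let tlXX := lam_typ T hX hX.
Let tlYY := lam_typ T hY hY.
Let trXX := rho_typ T hX hX.
Let trYY := rho_typ T hY hY.

Lemma ltimes_hmul : hmul (hb_ltimes T B) ::: ht T X X ~> X /\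
  hmul (hb_ltimes T B) ∘ lam T X X
  = (mul H ⊗ mul B)
     ∘ (idm H ⊗ ((idm H ⊗ act B) ∘ (Psi B H ⊗ idm H) ∘ (idm B ⊗ Delta H)) ⊗ idm B).
Proof.
rcb_types hB; rewrite /=; the_intro; apply: (lam_lift0 hopfH T hX hX); first by typ.
by diagram (bialg_rules hH, ract_rules hB).
Qed.

Lemma ltimes_hDelta : hDelta (hb_ltimes T B) ::: X ~> ht T X X /\
  rho T X X ∘ hDelta (hb_ltimes T B)
  = (idm H ⊗ ((idm B ⊗ mul H) ∘ (Psi H B ⊗ idm H) ∘ (idm H ⊗ coact B)) ⊗ idm B)
     ∘ (Delta H ⊗ Delta B).
Proof.
rcb_types hB; rewrite /=; the_intro; apply: (rho_lift0 hopfH T hX hX); first by typ.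
by diagram (bialg_rules hH, rcoact_rules hB).
Qed.

Lemma rtimes_hmul : hmul (hb_rtimes T C) ::: ht T Y Y ~> Y /\
  hmul (hb_rtimes T C) ∘ lam T Y Y
  = (mul C ⊗ mul H)
     ∘ (idm C ⊗ ((act C ⊗ idm H) ∘ (idm H ⊗ Psi H C) ∘ (Delta H ⊗ idm C)) ⊗ idm H).
Proof.
lcb_types hC; rewrite /=; the_intro; apply: (lam_lift0 hopfH T hY hY); first by typ.
by diagram (bialg_rules_l hH, lact_rules hC).
Qed.

Lemma rtimes_hDelta : hDelta (hb_rtimes T C) ::: Y ~> ht T Y Y /\
  rho T Y Y ∘ hDelta (hb_rtimes T C)
  = (idm C ⊗ ((mul H ⊗ idm C) ∘ (idm H ⊗ Psi C H) ∘ (coact C ⊗ idm H)) ⊗ idm H)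
     ∘ (Delta C ⊗ Delta H).
Proof.
lcb_types hC; rewrite /=; the_intro; apply: (rho_lift0 hopfH T hY hY); first by typ.
by diagram (bialg_rules_l hH, lcoact_rules hC).
Qed.

(** X is the right factor of Y ⊗_H X, so its structure maps must be compatible with H on the left,
    and those of Y on the right, to be combined by [hmap]. *)
Lemma ltimes_hmul_lmod : lmod_mor H (lact (ht T X X)) (lact X) (hmul (hb_ltimes T B)).
Proof.
have [tm E] := ltimes_hmul; rcb_types hB; types hXX; rewrite /lmod_mor.
apply: (lam_epi hopfH hX hX (A := H) (D := tun)); [typ | typ |].
by diagram (lact_lam T hX hX, E, bialg_rules hH).
Qed.

Lemma ltimes_hDelta_lmod : lmod_mor H (lact X) (lact (ht T X X)) (hDelta (hb_ltimes T B)).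
Proof.
have [tm E] := ltimes_hDelta; rcb_types hB; types hXX; rewrite /lmod_mor.
apply: (rho_mono0 hopfH hX hX); [typ | typ |].
by diagram (rho_lact hopfH T hX hX, E, bialg_rules hH).
Qed.

Lemma ltimes_hDelta_lcom : lcom_mor H (lcoact X) (lcoact (ht T X X)) (hDelta (hb_ltimes T B)).
Proof.
have [tm E] := ltimes_hDelta; rcb_types hB; types hXX; rewrite /lcom_mor.
apply: (rho_mono hopfH hX hX (A := H) (D := tun)); [typ | typ |].
by diagram (rho_lcoact T hX hX, E, bialg_rules hH).
Qed.

Lemma rtimes_hmul_rmod : rmod_mor H (ract (ht T Y Y)) (ract Y) (hmul (hb_rtimes T C)).
Proof.
have [tm E] := rtimes_hmul; lcb_types hC; types hYY; rewrite /rmod_mor.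
apply: (lam_epi hopfH hY hY (A := tun) (D := H)); [typ | typ |].
by diagram (ract_lam T hY hY, E, bialg_rules hH).
Qed.

Lemma rtimes_hDelta_rmod : rmod_mor H (ract Y) (ract (ht T Y Y)) (hDelta (hb_rtimes T C)).
Proof.
have [tm E] := rtimes_hDelta; lcb_types hC; types hYY; rewrite /rmod_mor.
apply: (rho_mono0 hopfH hY hY); [typ | typ |].
by diagram (rho_ract hopfH T hY hY, E, bialg_rules hH).
Qed.

Lemma rtimes_hDelta_rcom : rcom_mor H (rcoact Y) (rcoact (ht T Y Y)) (hDelta (hb_rtimes T C)).
Proof.
have [tm E] := rtimes_hDelta; lcb_types hC; types hYY; rewrite /rcom_mor.
apply: (rho_mono hopfH hY hY (A := tun) (D := H)); [typ | typ |].
by diagram (rho_rcoact T hY hY, E, bialg_rules hH).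
Qed.

(** * The square of the braiding of X and Y *)

Let hXY := ht_hopf T hX hY.
Let hYX := ht_hopf T hY hX.
Let tlXY := lam_typ T hX hY.
Let trXY := rho_typ T hX hY.

(** Inserting the outer units restricts [f] to the generators [B ⊠ C]; applying the outer counits
    projects to the cogenerators. *)
Definition core (f : mor K) : mor K :=
  (eps H ⊗ idm B ⊗ idm C ⊗ eps H) ∘ rho T X Y ∘ f ∘ lam T X Y
  ∘ (eta H ⊗ idm B ⊗ idm C ⊗ eta H).

Lemma ht_XY_ext (f f' : mor K) :
  f ::: ht T X Y ~> ht T X Y -> f' ::: ht T X Y ~> ht T X Y ->
  [/\ lmod_mor H (lact (ht T X Y)) (lact (ht T X Y)) f,
      rmod_mor H (ract (ht T X Y)) (ract (ht T X Y)) f,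
      lcom_mor H (lcoact (ht T X Y)) (lcoact (ht T X Y)) f &
      rcom_mor H (rcoact (ht T X Y)) (rcoact (ht T X Y)) f] ->
  [/\ lmod_mor H (lact (ht T X Y)) (lact (ht T X Y)) f',
      rmod_mor H (ract (ht T X Y)) (ract (ht T X Y)) f',
      lcom_mor H (lcoact (ht T X Y)) (lcoact (ht T X Y)) f' &
      rcom_mor H (rcoact (ht T X Y)) (rcoact (ht T X Y)) f'] ->
  core f = core f' -> f = f'.
Proof.
rcb_types hB; lcb_types hC; types hXY.
(* Bilinearity: g(h b ⊗ c h') = h g(b ⊗ c) h'. *)
pose free g := lact (ht T X Y) ∘ (idm H ⊗ ract (ht T X Y))
  ∘ (idm H ⊗ (g ∘ lam T X Y ∘ (eta H ⊗ idm B ⊗ idm C ⊗ eta H)) ⊗ idm H).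
(* Bicolinearity: up to braidings, g(b ⊗ c) is c_(-1) ⊗ core(b_0 ⊗ c_0) ⊗ b_1, because B is
   coinvariant on the left in X and C on the right in Y. *)
pose cofree g := (idm H ⊗ core g ⊗ idm H) ∘ (idm H ⊗ idm B ⊗ Psi H C)
  ∘ (idm H ⊗ coact B ⊗ idm C) ∘ (Psi B H ⊗ idm C) ∘ (idm B ⊗ coact C).
have freeE g : g ::: ht T X Y ~> ht T X Y ->
  lmod_mor H (lact (ht T X Y)) (lact (ht T X Y)) g ->
  rmod_mor H (ract (ht T X Y)) (ract (ht T X Y)) g -> g ∘ lam T X Y = free g.
  move=> tg gl gr.
  by rewrite /free; diagram (esym gl, esym gr, lact_lam T hX hY, ract_lam T hX hY, bialg_rules hH).
have cofreeE g : g ::: ht T X Y ~> ht T X Y ->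
  lcom_mor H (lcoact (ht T X Y)) (lcoact (ht T X Y)) g ->
  rcom_mor H (rcoact (ht T X Y)) (rcoact (ht T X Y)) g ->
  rho T X Y ∘ (g ∘ lam T X Y ∘ (eta H ⊗ idm B ⊗ idm C ⊗ eta H)) = cofree g.
  move=> tg gl gr.
  transitivity ((idm H ⊗ ((eps H ⊗ idm B ⊗ idm C ⊗ eps H) ∘ rho T X Y) ⊗ idm H)
    ∘ (idm H ⊗ rcoact (ht T X Y)) ∘ lcoact (ht T X Y) ∘ g ∘ lam T X Y
    ∘ (eta H ⊗ idm B ⊗ idm C ⊗ eta H)).
    by diagram (rho_lcoact T hX hY, rho_rcoact T hX hY, bialg_rules hH).
  rewrite /cofree /core.
  diagram (gl, gr, lcoact_lam hopfH T hX hY, rcoact_lam hopfH T hX hY, bialg_rules hH).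
move=> tf tf' [fl fr fcl fcr] [fl' fr' fcl' fcr'] E.
apply: (lam_epi0 hopfH hX hY); [typ | typ |].
rewrite !freeE // /free; congr (_ ∘ (_ ⊗ _ ⊗ _)).
apply: (rho_mono0 hopfH hX hY); [typ | typ |].
by rewrite !cofreeE // /cofree E.
Qed.

Hypothesis ident : [/\ hcar (ht T Y X) = C ⊠ H ⊠ B, lam T Y X = idm C ⊗ mul H ⊗ idm B
  & rho T Y X = idm C ⊗ Delta H ⊗ idm B].
Let carE : hcar (ht T Y X) = C ⊠ H ⊠ B. Proof. by case: ident. Qed.
Let lamE : lam T Y X = idm C ⊗ mul H ⊗ idm B. Proof. by case: ident. Qed.
Let rhoE : rho T Y X = idm C ⊗ Delta H ⊗ idm B. Proof. by case: ident. Qed.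

Local Notation rules :=
  (bialg_rules hH, ract_rules hB, lact_rules hC, rcoact_rules hB, lcoact_rules hC).
Local Notation E_XY :=
  ((lact Y ⊗ ract X) ∘ (idm H ⊗ Psi X Y ⊗ idm H) ∘ (lcoact X ⊗ rcoact Y)).
Local Notation E_YX :=
  ((lact X ⊗ ract Y) ∘ (idm H ⊗ Psi Y X ⊗ idm H) ∘ (lcoact Y ⊗ rcoact X)).

(** A counit on one of the two H strands is a retraction of [rho T Y X], which solves the defining
    equation for the braiding. In [hbraid_YX] a unit gives a section of [lam T Y X]. *)
Lemma hbraid_XY : hbraid T X Y ::: ht T X Y ~> C ⊠ H ⊠ B /\
  hbraid T X Y ∘ lam T X Y = (idm C ⊗ idm H ⊗ eps H ⊗ idm B) ∘ E_XY.
Proof.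
have [tb E] := hbraid_spec hopfH T hX hY; rewrite carE in tb; split=> //.
rcb_types hB; lcb_types hC; rewrite -E rhoE; diagram (bialg_rules hH).
Qed.

Lemma hbraid_YX : hbraid T Y X ::: C ⊠ H ⊠ B ~> ht T X Y /\
  rho T X Y ∘ hbraid T Y X = E_YX ∘ (idm C ⊗ idm H ⊗ eta H ⊗ idm B).
Proof.
have [tb E] := hbraid_spec hopfH T hY hX; rewrite carE in tb; split=> //.
rcb_types hB; lcb_types hC; rewrite -E lamE; diagram (bialg_rules hH).
Qed.

Lemma hbraid_involutive :
  Psi C B ∘ Psi B C
  = (act B ⊗ act C) ∘ (idm B ⊗ Psi H H ⊗ idm C) ∘ (coact B ⊗ coact C)
  <-> hbraid T Y X ∘ hbraid T X Y = idm (ht T X Y).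
Proof.
rcb_types hB; lcb_types hC; types hXY.
have [t1 E1] := hbraid_XY; have [t2 E2] := hbraid_YX.
(* On 1 ⊗ b ⊗ c ⊗ 1 the coactions of the first braiding produce only units, and those of the second
   are removed by the outer counits. *)
have core1 : core (hbraid T Y X ∘ hbraid T X Y) = Psi C B ∘ Psi B C.
  rewrite /core.
  diagram (E1, E2, rules).
have core2 : core (idm (ht T X Y))
  = (act B ⊗ act C) ∘ (idm B ⊗ Psi H H ⊗ idm C) ∘ (coact B ⊗ coact C).
  rewrite /core.
  diagram (rho_lam T hX hY, rules).
split=> [E|E]; last by rewrite -core1 -core2 E.
apply: ht_XY_ext; [typ | typ | | | by rewrite core1 core2 E].
  have [t1' _] := hbraid_spec hopfH T hX hY; have [t2' _] := hbraid_spec hopfH T hY hX.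
  have t12 := ht_hopf T hY hX; types t12.
  have := (hbraid_lmod hopfH T hX hY, hbraid_rmod hopfH T hX hY,
           hbraid_lcom hopfH T hX hY, hbraid_rcom hopfH T hX hY).
  move=> [[[l1 r1] lc1] rc1].
  have := (hbraid_lmod hopfH T hY hX, hbraid_rmod hopfH T hY hX,
           hbraid_lcom hopfH T hY hX, hbraid_rcom hopfH T hY hX).
  move=> [[[l2 r2] lc2] rc2].
  (* The typings with [C ⊠ H ⊠ B] are dropped: in these equations Y ⊗_H X is a single strand, as in
     the types of its actions and coactions. *)
  clear t1 t2; rewrite /lmod_mor /rmod_mor /lcom_mor /rcom_mor; split.
  - by diagram (l1, l2).
  - by diagram (r1, r2).
  - by diagram (lc1, lc2).
  - by diagram (rc1, rc2).
by rewrite /lmod_mor /rmod_mor /lcom_mor /rcom_mor; split; diagram.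
Qed.

(** * Explicit structure maps of Z *)

Local Notation Z := (hb_tensor T (hb_rtimes T C) (hb_ltimes T B)).

Lemma mulZ_formula : hmul Z ∘ lam T (ht T Y X) (ht T Y X)
  = (mul C ⊗ idm H ⊗ mul B)
    ∘ (idm C ⊗ act C ⊗ mul H ⊗ act B ⊗ idm B)
    ∘ (idm C ⊗ idm H ⊗ Psi H C ⊗ Psi B H ⊗ idm H ⊗ idm B)
    ∘ (idm C ⊗ Delta H ⊗ Psi B C ⊗ Delta H ⊗ idm B).
Proof.
rcb_types hB; lcb_types hC; have [tb bE] := hbraid_XY.
have [tY YE] := rtimes_hmul; have [tX XE] := ltimes_hmul.
(* The lift is the braiding from [hbraid_XY] followed by the section of [lam T Y X] that inserts a
   unit. *)
set t := (idm C ⊗ idm H ⊗ eta H ⊗ idm B) ∘ (idm C ⊗ idm H ⊗ eps H ⊗ idm B) ∘ E_XY.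
have tt : t ::: X ⊠ Y ~> Y ⊠ X by rewrite /t; typ.
have tE : hbraid T X Y ∘ lam T X Y = lam T Y X ∘ t.
  by rewrite bE lamE /t; diagram (bialg_rules hH).
have [tm M] : hmul Z ::: ht T (ht T Y X) (ht T Y X) ~> ht T Y X /\
  hmul Z ∘ lam T (ht T Y X) (ht T Y X) ∘ (lam T Y X ⊗ lam T Y X)
  = lam T Y X ∘ ((hmul (hb_rtimes T C) ∘ lam T Y Y) ⊗ (hmul (hb_ltimes T B) ∘ lam T X X))
    ∘ (idm (C ⊠ H) ⊗ t ⊗ idm (H ⊠ B)).
  exact: (hb_tensor_mul hopfH (A := hb_rtimes T C) (D := hb_ltimes T B) hY hX tY tX
    rtimes_hmul_rmod ltimes_hmul_lmod tt tE).
have tl := lam_typ T hYX hYX; rewrite carE in tm tl.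
rewrite XE YE lamE /t in M.
(* A section of [lam ⊗ lam] is inserted. Its units stand next to the middle factors, so that [t] is
   evaluated on 1 ⊗ b ⊗ c ⊗ 1. *)
transitivity (hmul Z ∘ lam T (ht T Y X) (ht T Y X)
  ∘ ((idm C ⊗ mul H ⊗ idm B) ⊗ (idm C ⊗ mul H ⊗ idm B))
  ∘ (idm C ⊗ idm H ⊗ eta H ⊗ idm B ⊗ idm C ⊗ eta H ⊗ idm H ⊗ idm B)).
  by diagram (bialg_rules hH).
rewrite M; diagram rules.
Qed.

Lemma DeltaZ_formula : rho T (ht T Y X) (ht T Y X) ∘ hDelta Z
  = (idm C ⊗ mul H ⊗ Psi C B ⊗ mul H ⊗ idm B)
    ∘ (idm C ⊗ idm H ⊗ Psi C H ⊗ Psi H B ⊗ idm H ⊗ idm B)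
    ∘ (idm C ⊗ coact C ⊗ Delta H ⊗ coact B ⊗ idm B)
    ∘ (Delta C ⊗ idm H ⊗ Delta B).
Proof.
rcb_types hB; lcb_types hC; have [tb bE] := hbraid_YX.
have [tY YE] := rtimes_hDelta; have [tX XE] := ltimes_hDelta.
set t := E_YX ∘ (idm C ⊗ idm H ⊗ eta H ⊗ idm B) ∘ (idm C ⊗ idm H ⊗ eps H ⊗ idm B).
have tt : t ::: Y ⊠ X ~> X ⊠ Y by rewrite /t; typ.
have tE : rho T X Y ∘ hbraid T Y X = t ∘ rho T Y X.
  by rewrite bE rhoE /t; diagram (bialg_rules hH).
have [tm M] : hDelta Z ::: ht T Y X ~> ht T (ht T Y X) (ht T Y X) /\
  (rho T Y X ⊗ rho T Y X) ∘ (rho T (ht T Y X) (ht T Y X) ∘ hDelta Z)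
  = (idm (C ⊠ H) ⊗ t ⊗ idm (H ⊠ B))
    ∘ ((rho T Y Y ∘ hDelta (hb_rtimes T C)) ⊗ (rho T X X ∘ hDelta (hb_ltimes T B)))
    ∘ rho T Y X.
  exact: (hb_tensor_Delta hopfH (A := hb_rtimes T C) (D := hb_ltimes T B) hY hX tY tX
    rtimes_hDelta_rmod ltimes_hDelta_lmod rtimes_hDelta_rcom ltimes_hDelta_lcom tt tE).
have tl := rho_typ T hYX hYX; rewrite carE in tm tl.
rewrite XE YE rhoE /t in M.
(* Dually, a retraction of [rho ⊗ rho] with counits next to the middle factors is applied. *)
transitivity (
  (idm C ⊗ idm H ⊗ eps H ⊗ idm B ⊗ idm C ⊗ eps H ⊗ idm H ⊗ idm B)
  ∘ (((idm C ⊗ Delta H ⊗ idm B) ⊗ (idm C ⊗ Delta H ⊗ idm B))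
  ∘ (rho T (ht T Y X) (ht T Y X) ∘ hDelta Z))).
  by diagram (bialg_rules hH).
rewrite M; diagram rules.
Qed.

Lemma etaZ_formula : heta Z ∘ eta H = eta C ⊗ eta H ⊗ eta B.
Proof.
rcb_types hB; lcb_types hC.
have -> : heta Z ∘ eta H
  = lam T Y X ∘ (((eta C ⊗ idm H) ∘ eta H) ⊗ ((idm H ⊗ eta B) ∘ eta H)).
  apply: (hb_tensor_eta hopfH T (A := hb_rtimes T C) (D := hb_ltimes T B) hY hX);
    rewrite /= ?/rmod_mor ?/lmod_mor; [typ | typ | diagram | diagram].
by rewrite lamE; diagram (bialg_rules hH).
Qed.

Lemma epsZ_formula : eps H ∘ heps Z = eps C ⊗ eps H ⊗ eps B.
Proof.
rcb_types hB; lcb_types hC.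
have tYX := lam_typ T hY hX.
have [te E] : heps Z ::: ht T Y X ~> H /\ eps H ∘ heps Z ∘ lam T Y X
  = (eps H ∘ (eps C ⊗ idm H)) ⊗ (eps H ∘ (idm H ⊗ eps B)).
  apply: (hb_tensor_eps hopfH T (A := hb_rtimes T C) (D := hb_ltimes T B) hY hX);
    rewrite /= ?/rmod_mor ?/lmod_mor; [typ | typ | diagram | diagram].
apply: (lam_epi0 hopfH hY hX); [typ | rewrite carE; typ |].
by rewrite E lamE; diagram (bialg_rules hH).
Qed.
End Proposition.

(** * The cross product bialgebra *)

(** The equation Delta(u v) = Delta(u) Delta(v) for generalised elements [u] and [v] of [A]; for two
    identities it is the bialgebra axiom. *)
Definition multiplicative (K : sbmc) (A : bialg_data K) (u v : mor K) : Prop :=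
  Delta A ∘ mul A ∘ (u ⊗ v)
  = (mul A ⊗ mul A) ∘ (idm A ⊗ Psi A A ⊗ idm A) ∘ (Delta A ⊗ Delta A) ∘ (u ⊗ v).

Section Multiplicative.
Variables (K : sbmc) (A : bialg_data K).
Hypotheses (algA : algebra A) (Delta_t : Delta A ::: A ~> A ⊠ A).
Let mul_t : mul A ::: A ⊠ A ~> A. Proof. by case: algA. Qed.
Let mA : mul A ∘ (mul A ⊗ idm A) = mul A ∘ (idm A ⊗ mul A). Proof. by case: algA. Qed.

Section Three.
Variables (U V W : obj K) (u v w uv vw : mor K).
Hypotheses (tu : u ::: U ~> A) (tv : v ::: V ~> A) (tw : w ::: W ~> A).
Hypotheses (uvE : mul A ∘ (u ⊗ v) = uv) (vwE : mul A ∘ (v ⊗ w) = vw).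

(** Given the two hypotheses, either side says Delta(u v w) = Delta(u) Delta(v) Delta(w). The
    products [uv] and [vw] are parameters so that they can be supplied in reordered form. *)
Lemma multiplicative_assoc : multiplicative A u v -> multiplicative A v w ->
  multiplicative A uv w <-> multiplicative A u vw.
Proof.
rewrite /multiplicative -uvE -vwE => Muv Mvw.
have -> : Delta A ∘ mul A ∘ (u ⊗ (mul A ∘ (v ⊗ w)))
  = Delta A ∘ mul A ∘ ((mul A ∘ (u ⊗ v)) ⊗ w) by diagram mA.
have -> : (mul A ⊗ mul A) ∘ (idm A ⊗ Psi A A ⊗ idm A) ∘ (Delta A ⊗ Delta A)
    ∘ (u ⊗ (mul A ∘ (v ⊗ w)))
  = (mul A ⊗ mul A) ∘ (idm A ⊗ Psi A A ⊗ idm A) ∘ (Delta A ⊗ Delta A)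
    ∘ ((mul A ∘ (u ⊗ v)) ⊗ w) by diagram (Muv, Mvw, mA).
by [].
Qed.
End Three.

Lemma multiplicative_compl (U V U' : obj K) (u v f : mor K) :
  u ::: U ~> A -> v ::: V ~> A -> f ::: U' ~> U ->
  multiplicative A u v -> multiplicative A (u ∘ f) v.
Proof. by rewrite /multiplicative => tu tv tf M; diagram M. Qed.

Lemma multiplicative_compr (U V V' : obj K) (u v g : mor K) :
  u ::: U ~> A -> v ::: V ~> A -> g ::: V' ~> V ->
  multiplicative A u v -> multiplicative A u (v ∘ g).
Proof. by rewrite /multiplicative => tu tv tf M; diagram M. Qed.
End Multiplicative.

Section CrossProduct.
Variables (K : sbmc) (H : bialg_data K).
Hypothesis hH : bialgebra H.
Variables (B C : xbialg_data K).
Hypotheses (hB : right_crossed_bialgebra H B) (hC : left_crossed_bialgebra H C).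
Let mul_t := mul_typ hH.
Let eta_t := eta_typ hH.
Let Delta_t := Delta_typ hH.
Let eps_t := eps_typ hH.

Definition mulZ : mor K :=
  (mul C ⊗ idm H ⊗ mul B)
  ∘ (idm C ⊗ act C ⊗ mul H ⊗ act B ⊗ idm B)
  ∘ (idm C ⊗ idm H ⊗ Psi H C ⊗ Psi B H ⊗ idm H ⊗ idm B)
  ∘ (idm C ⊗ Delta H ⊗ Psi B C ⊗ Delta H ⊗ idm B).
Definition DeltaZ : mor K :=
  (idm C ⊗ mul H ⊗ Psi C B ⊗ mul H ⊗ idm B)
  ∘ (idm C ⊗ idm H ⊗ Psi C H ⊗ Psi H B ⊗ idm H ⊗ idm B)
  ∘ (idm C ⊗ coact C ⊗ Delta H ⊗ coact B ⊗ idm B)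
  ∘ (Delta C ⊗ idm H ⊗ Delta B).
Definition cross_product : bialg_data K :=
  BialgData (C ⊠ H ⊠ B) mulZ (eta C ⊗ eta H ⊗ eta B) DeltaZ (eps C ⊗ eps H ⊗ eps B).
Local Notation Z := cross_product.
Local Notation rules := (bialg_rules hH, ract_rules hB, lact_rules hC, bialg_rules (rcb_bialg hB),
  bialg_rules (lcb_bialg hC), rcoact_rules hB, lcoact_rules hC).
Local Notation rules_l := (bialg_rules_l hH, ract_rules hB, lact_rules hC,
  bialg_rules_l (rcb_bialg hB), bialg_rules_l (lcb_bialg hC), rcoact_rules hB, lcoact_rules hC).

Lemma cross_product_algebra : algebra Z.
Proof.
rcb_types hB; lcb_types hC.
split; rewrite /= /mulZ; [typ | typ | | |].
all: by diagram rules.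
Qed.

Lemma cross_product_coalgebra : coalgebra Z.
Proof.
rcb_types hB; lcb_types hC.
split; rewrite /= /DeltaZ; [typ | typ | | |].
all: by diagram rules.
Qed.

Hypothesis inv : Psi C B ∘ Psi B C
  = (act B ⊗ act C) ∘ (idm B ⊗ Psi H H ⊗ idm C) ∘ (coact B ⊗ coact C).

Let iC := idm C ⊗ eta H ⊗ eta B.
Let iH := eta C ⊗ idm H ⊗ eta B.
Let iB := eta C ⊗ eta H ⊗ idm B.
Let iCH := idm C ⊗ idm H ⊗ eta B.
Let iHB := eta C ⊗ idm H ⊗ idm B.

Lemma mult_HH : multiplicative Z iH iH.
Proof.
rcb_types hB; lcb_types hC; rewrite /multiplicative /= /mulZ /DeltaZ /iH.
by diagram rules.
Qed.

Lemma mult_CHB : multiplicative Z iCH iB.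
Proof.
rcb_types hB; lcb_types hC; rewrite /multiplicative /= /mulZ /DeltaZ /iCH /iB.
by diagram rules.
Qed.

Lemma mult_CH : multiplicative Z iC iH.
Proof.
rcb_types hB; lcb_types hC; rewrite /multiplicative /= /mulZ /DeltaZ /iC /iH.
by diagram rules.
Qed.

Lemma mult_HB : multiplicative Z iH iB.
Proof.
rcb_types hB; lcb_types hC; rewrite /multiplicative /= /mulZ /DeltaZ /iH /iB.
by diagram rules.
Qed.

Lemma mult_BB : multiplicative Z iB iB.
Proof.
rcb_types hB; lcb_types hC; rewrite /multiplicative /= /mulZ /DeltaZ /iB.
by diagram rules.
Qed.

Lemma mult_CC : multiplicative Z iC iC.
Proof.
rcb_types hB; lcb_types hC; rewrite /multiplicative /= /mulZ /DeltaZ /iC.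
by diagram rules_l.
Qed.

Lemma mult_BH : multiplicative Z iB iH.
Proof.
rcb_types hB; lcb_types hC; rewrite /multiplicative /= /mulZ /DeltaZ /iB /iH.
(* Here the right-hand side of the crossed module axiom is exposed as one factor, to be replaced
   once. *)
transitivity ((eta C ⊗ idm H ⊗ idm B ⊗ eta C ⊗ idm H ⊗ idm B)
  ∘ (idm H ⊗ ((idm B ⊗ mul H) ∘ (Psi H B ⊗ idm H) ∘ (idm H ⊗ (coact B ∘ act B))
      ∘ (Psi B H ⊗ idm H) ∘ (idm B ⊗ Delta H)) ⊗ act B)
  ∘ (idm H ⊗ idm B ⊗ Psi B H ⊗ idm H) ∘ (Psi (B ⊠ B) H ⊗ idm H ⊗ idm H)
  ∘ (Delta B ⊗ ((idm H ⊗ Delta H) ∘ Delta H))).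
  by diagram (rules, rcb_Delta_act hB).
by rewrite -rcb_crossed //; diagram rules.
Qed.

Lemma mult_HC : multiplicative Z iH iC.
Proof.
rcb_types hB; lcb_types hC; rewrite /multiplicative /= /mulZ /DeltaZ /iC /iH.
transitivity ((idm C ⊗ idm H ⊗ eta B ⊗ idm C ⊗ idm H ⊗ eta B)
  ∘ (act C ⊗ ((mul H ⊗ idm C) ∘ (idm H ⊗ Psi C H) ∘ ((coact C ∘ act C) ⊗ idm H)
      ∘ (idm H ⊗ Psi H C) ∘ (Delta H ⊗ idm C)) ⊗ idm H)
  ∘ (idm H ⊗ Psi H C ⊗ idm C ⊗ idm H) ∘ (idm H ⊗ idm H ⊗ Psi H (C ⊠ C))
  ∘ (((Delta H ⊗ idm H) ∘ Delta H) ⊗ Delta C)).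
  by diagram (rules_l, lcb_Delta_act hC).
by rewrite -lcb_crossed //; diagram rules_l.
Qed.

Lemma mult_BC : multiplicative Z iB iC.
Proof.
rcb_types hB; lcb_types hC; rewrite /multiplicative /= /mulZ /DeltaZ /iC /iB.
(* The braiding of B and C in the product is brought next to the one in the coproduct, where the
   hypothesis replaces their composite. *)
transitivity ((idm C ⊗ idm H ⊗ (Psi C B ∘ Psi B C) ⊗ idm H ⊗ idm B)
  ∘ (idm C ⊗ idm H ⊗ idm B ⊗ Psi (H ⊠ B) C) ∘ (idm C ⊗ Psi (B ⊠ H ⊠ B) H ⊗ idm C)
  ∘ (Psi (B ⊠ H ⊠ B) C ⊗ idm H ⊗ idm C)
  ∘ (((coact B ⊗ idm B) ∘ Delta B) ⊗ ((idm C ⊗ coact C) ∘ Delta C))).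
  by diagram rules.
by rewrite inv; diagram rules.
Qed.

Let tC : iC ::: C ~> Z. Proof. by rcb_types hB; lcb_types hC; rewrite /iC /=; typ. Qed.
Let tH : iH ::: H ~> Z. Proof. by rcb_types hB; lcb_types hC; rewrite /iH /=; typ. Qed.
Let tB : iB ::: B ~> Z. Proof. by rcb_types hB; lcb_types hC; rewrite /iB /=; typ. Qed.
Let tCH : iCH ::: C ⊠ H ~> Z. Proof. by rcb_types hB; lcb_types hC; rewrite /iCH /=; typ. Qed.
Let tHB : iHB ::: H ⊠ B ~> Z. Proof. by rcb_types hB; lcb_types hC; rewrite /iHB /=; typ. Qed.

(** As Z is the product of C and HB, and HB that of H and B, it suffices by [multiplicative_assoc]
    to have each generator multiplicative against Z. A product in the wrong order is first
    straightened to the order C, H, B, which reduces it to pairs already treated. *)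
Lemma cross_product_multiplicative : multiplicative Z (idm Z) (idm Z).
Proof.
rcb_types hB; lcb_types hC.
have [algZ [tD _ _ _ _]] := (cross_product_algebra, cross_product_coalgebra).
have [tm _ _ _ _] := algZ.
have tI : idm Z ::: Z ~> Z by rewrite dom_idm cod_idm.
have assoc := multiplicative_assoc algZ tD.
have compl := multiplicative_compl algZ tD; have compr := multiplicative_compr algZ tD.
(* The straightening maps h ⊗ c |-> h_1 c ⊗ h_2 and b ⊗ h |-> h_1 ⊗ b h_2. *)
pose sHC := (act C ⊗ idm H) ∘ (idm H ⊗ Psi H C) ∘ (Delta H ⊗ idm C).
pose sBH := (idm H ⊗ act B) ∘ (Psi B H ⊗ idm H) ∘ (idm B ⊗ Delta H).
have tHC : sHC ::: H ⊠ C ~> C ⊠ H by rewrite /sHC; typ.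
have tBH : sBH ::: B ⊠ H ~> H ⊠ B by rewrite /sBH; typ.
have C_H : mul Z ∘ (iC ⊗ iH) = iCH.
  by rewrite /= /mulZ /iC /iH /iCH; diagram rules.
have H_B : mul Z ∘ (iH ⊗ iB) = iHB.
  by rewrite /= /mulZ /iB /iH /iHB; diagram rules.
have C_HB : mul Z ∘ (iC ⊗ iHB) = idm Z.
  by rewrite /= /mulZ /iC /iHB; diagram rules.
have C_C : mul Z ∘ (iC ⊗ iC) = iC ∘ mul C.
  by rewrite /= /mulZ /iC; diagram rules.
have H_H : mul Z ∘ (iH ⊗ iH) = iH ∘ mul H.
  by rewrite /= /mulZ /iH; diagram rules.
have B_B : mul Z ∘ (iB ⊗ iB) = iB ∘ mul B.
  by rewrite /= /mulZ /iB; diagram rules.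
have H_C : mul Z ∘ (iH ⊗ iC) = iCH ∘ sHC.
  by rewrite /= /mulZ /iH /iC /iCH /sHC; diagram rules.
have B_H : mul Z ∘ (iB ⊗ iH) = iHB ∘ sBH.
  by rewrite /= /mulZ /iB /iH /iHB /sBH; diagram rules.
have H_HB : mul Z ∘ (iH ⊗ iHB) = iHB ∘ (mul H ⊗ idm B).
  by rewrite /= /mulZ /iH /iHB; diagram rules.
have B_HB : mul Z ∘ (iB ⊗ iHB) = iHB ∘ ((idm H ⊗ mul B) ∘ (sBH ⊗ idm B)).
  by rewrite /= /mulZ /iB /iHB /sBH; diagram rules.
have B_C : mul Z ∘ (iB ⊗ iC) = mul Z ∘ (iC ⊗ iB) ∘ Psi B C.
  by rewrite /= /mulZ /iB /iC; diagram rules.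
have HB_eta : iHB ∘ (eta H ⊗ idm B) = iB by rewrite /iHB /iB; diagram.
have tmC := mul_typ (lcb_bialg hC); have tmB := mul_typ (rcb_bialg hB).
have tbC : mul Z ∘ (iC ⊗ iB) ::: C ⊠ B ~> Z by rewrite /= /mulZ /iC /iB; typ.
(* Generalising Z makes its carrier one strand and its product one box for [typ]. *)
have tmI f n : f ::: n ~> Z -> mul Z ∘ (f ⊗ idm Z) ::: n ⊠ Z ~> Z.
  by move=> tf; move: tm tf; case: (Z) => /= *; typ.
have idl n f : f ::: n ~> Z -> idm Z ∘ f = f by case=> _ <-; rewrite comp_idl.
have tmHB : mul H ⊗ idm B ::: H ⊠ (H ⊠ B) ~> H ⊠ B by typ.
have tBHB : (idm H ⊗ mul B) ∘ (sBH ⊗ idm B) ::: B ⊠ (H ⊠ B) ~> H ⊠ B by typ.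
have teB : eta H ⊗ idm B ::: B ~> H ⊠ B by typ.
have tPsi : Psi B C ::: B ⊠ C ~> C ⊠ B by typ.
have tBI := tmI _ _ tB; have tHBI := tmI _ _ tHB.
have M_C_HB : multiplicative Z iC iHB.
  by apply/(assoc _ _ _ _ _ _ _ _ tC tH tB C_H H_B mult_CH mult_HB)/mult_CHB.
have M_C_I : multiplicative Z iC (idm Z).
  apply/(assoc _ _ _ _ _ _ _ _ tC tC tHB C_C C_HB mult_CC M_C_HB).
  exact: compl tC tHB tmC M_C_HB.
have M_H_HB : multiplicative Z iH iHB.
  apply/(assoc _ _ _ _ _ _ _ _ tH tH tB H_H H_B mult_HH mult_HB).
  exact: compl tH tB mul_t mult_HB.
have M_CH_HB : multiplicative Z iCH iHB.
  apply/(assoc _ _ _ _ _ _ _ _ tC tH tHB C_H H_HB mult_CH M_H_HB).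
  exact: compr tC tHB tmHB M_C_HB.
have M_H_I : multiplicative Z iH (idm Z).
  apply/(assoc _ _ _ _ _ _ _ _ tH tC tHB H_C C_HB mult_HC M_C_HB).
  exact: compl tCH tHB tHC M_CH_HB.
have M_HB_B : multiplicative Z iHB iB.
  apply/(assoc _ _ _ _ _ _ _ _ tH tB tB H_B B_B mult_HB mult_BB).
  exact: compr tH tB tmB mult_HB.
have M_B_HB : multiplicative Z iB iHB.
  apply/(assoc _ _ _ _ _ _ _ _ tB tH tB B_H H_B mult_BH mult_HB).
  exact: compl tHB tB tBH M_HB_B.
have M_C_B : multiplicative Z iC iB by rewrite -HB_eta; exact: compr tC tHB teB M_C_HB.
have M_CB_HB : multiplicative Z (mul Z ∘ (iC ⊗ iB)) iHB.
  apply/(assoc _ _ _ _ _ _ _ _ tC tB tHB erefl B_HB M_C_B M_B_HB).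
  exact: compr tC tHB tBHB M_C_HB.
have M_B_I : multiplicative Z iB (idm Z).
  apply/(assoc _ _ _ _ _ _ _ _ tB tC tHB B_C C_HB mult_BC M_C_HB).
  exact: compl tbC tHB tPsi M_CB_HB.
have M_HB_I : multiplicative Z iHB (idm Z).
  apply/(assoc _ _ _ _ _ _ _ _ tH tB tI H_B erefl mult_HB M_B_I).
  (* Any morphism into Z is the identity of Z composed with it, so multiplicativity against Z
     specialises to it. *)
  by rewrite -(idl _ _ tBI); exact: compr tH tI tBI M_H_I.
apply/(assoc _ _ _ _ _ _ _ _ tC tHB tI C_HB erefl M_C_HB M_HB_I).
by rewrite -(idl _ _ tHBI); exact: compr tC tI tHBI M_C_I.
Qed.

Lemma cross_product_bialgebra : bialgebra Z.
Proof.
rcb_types hB; lcb_types hC; have M := cross_product_multiplicative.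
have [tm te _ _ _] := cross_product_algebra; have [tD tp _ _ _] := cross_product_coalgebra.
split; [exact: cross_product_algebra | exact: cross_product_coalgebra | | | split].
- have {}M := M; rewrite /multiplicative in M.
  have -> : Delta Z ∘ mul Z = Delta Z ∘ mul Z ∘ (idm Z ⊗ idm Z) by diagram.
  by rewrite M; diagram.
- by rewrite /= /DeltaZ; diagram rules.
- by rewrite /= /mulZ; diagram rules.
- by rewrite /=; diagram rules.
Qed.
End CrossProduct.

(** * Retracts of bialgebras, and split morphisms *)

Section Retract.
Variables (K : sbmc) (A E : bialg_data K) (i p : mor K).
Hypotheses (hE : bialgebra E) (ip : p ∘ i = idm A).
Hypotheses (hi : bialgebra_morphism A E i) (hp : bialgebra_morphism E A p).
Hypotheses (tm : mul A ::: A ⊠ A ~> A) (te : eta A ::: tun ~> A).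
Hypotheses (tD : Delta A ::: A ~> A ⊠ A) (tp : eps A ::: A ~> tun).

(** Equations into [A] are detected by [i] and equations out of [A] by [p]. Applied to Z, this
    proves the axioms of the two biproducts. *)
Lemma bialgebra_retract : bialgebra A.
Proof.
bialg_types hE.
case: hi => -[i_t i_mul i_eta] [_ i_Delta i_eps].
case: hp => -[p_t p_mul p_eta] [_ p_Delta p_eps].
have through_l (a : obj K) (f g : mor K) : f ::: a ~> A -> g ::: a ~> A ->
  i ∘ f = i ∘ g -> f = g.
  move=> tf tg fg; transitivity (p ∘ (i ∘ f)); first by diagram ip.
  by rewrite fg; diagram ip.
have through_r (a : obj K) (f g : mor K) : f ::: A ~> a -> g ::: A ~> a ->
  f ∘ p = g ∘ p -> f = g.
  move=> tf tg fg; transitivity (f ∘ p ∘ i); first by diagram ip.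
  by rewrite fg; diagram ip.
split; [split => // | split => // | | | split].
- apply: (through_l (A ⊠ A ⊠ A)); [typ | typ | diagram (i_mul, mulA hE)].
- apply: (through_l A); [typ | typ | diagram (i_mul, i_eta, mul1l hE)].
- apply: (through_l A); [typ | typ | diagram (i_mul, i_eta, mul1r hE)].
- apply: (through_r (A ⊠ A ⊠ A)); [typ | typ | diagram (p_Delta, DeltaA hE)].
- apply: (through_r A); [typ | typ | diagram (p_Delta, p_eps, Delta1l hE)].
- apply: (through_r A); [typ | typ | diagram (p_Delta, p_eps, Delta1r hE)].
(* Neither [i] nor [p] alone transports an axiom mixing product and coproduct; inserting [p ∘ i]
   between them carries the computation into [E]. *)
- transitivity (Delta A ∘ (p ∘ i) ∘ mul A); first by diagram ip.
  transitivity ((mul A ⊗ mul A) ∘ (idm A ⊗ Psi A A ⊗ idm A)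
    ∘ ((Delta A ∘ (p ∘ i)) ⊗ (Delta A ∘ (p ∘ i)))); last by diagram ip.
  by diagram (i_mul, p_Delta, Delta_mul hE, p_mul).
- transitivity (Delta A ∘ (p ∘ i) ∘ eta A); first by diagram ip.
  by diagram (i_eta, p_Delta, Delta_eta hE, p_eta).
- transitivity (eps A ∘ (p ∘ i) ∘ mul A); first by diagram ip.
  by diagram (i_mul, p_eps, eps_mul hE, i_eps).
- transitivity (eps A ∘ (p ∘ i) ∘ eta A); first by diagram ip.
  by diagram (i_eta, p_eps, eps_eta hE).
Qed.
End Retract.

Lemma split_mono (K : sbmc) (a b : obj K) (f g : mor K) :
  f ::: a ~> b -> g ::: b ~> a -> g ∘ f = idm a -> mono f.
Proof.
move=> tf tg gf h k; rewrite (proj1 tf) => fh fk hk E.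
have th : h ::: dom h ~> a by [].
have tk : k ::: dom h ~> a by [].
transitivity (g ∘ (f ∘ h)); first by diagram gf.
by rewrite E; diagram gf.
Qed.

Lemma split_epi (K : sbmc) (a b : obj K) (f g : mor K) :
  f ::: a ~> b -> g ::: b ~> a -> f ∘ g = idm b -> epi f.
Proof.
move=> tf tg fg h k; rewrite (proj2 tf) => fh fk hk E.
have th : h ::: b ~> cod h by [].
have tk : k ::: b ~> cod h by [].
transitivity (h ∘ f ∘ g); first by diagram fg.
by rewrite E; diagram fg.
Qed.

(** * The structural morphisms between Z, the biproducts and C ⊗ B *)

Section Morphisms.
Variables (K : sbmc) (H : bialg_data K).
Hypothesis hH : bialgebra H.
Variables (B C : xbialg_data K).
Hypotheses (hB : right_crossed_bialgebra H B) (hC : left_crossed_bialgebra H C).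
Let mul_t := mul_typ hH.
Let eta_t := eta_typ hH.
Let Delta_t := Delta_typ hH.
Let eps_t := eps_typ hH.
Local Notation Z := (cross_product H B C).
Local Notation rules := (bialg_rules hH, ract_rules hB, lact_rules hC, bialg_rules (rcb_bialg hB),
  bialg_rules (lcb_bialg hC), rcoact_rules hB, lcoact_rules hC).

Lemma rtimes_into : bialgebra_morphism (rtimes H C) Z (idm (C ⊠ H) ⊗ eta B).
Proof.
rcb_types hB; lcb_types hC; do !split; rewrite /= ?/mulZ ?/DeltaZ; solve [typ | diagram rules].
Qed.

Lemma ltimes_into : bialgebra_morphism (ltimes H B) Z (eta C ⊗ idm (H ⊠ B)).
Proof.
rcb_types hB; lcb_types hC; do !split; rewrite /= ?/mulZ ?/DeltaZ; solve [typ | diagram rules].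
Qed.

Lemma onto_rtimes : bialgebra_morphism Z (rtimes H C) (idm (C ⊠ H) ⊗ eps B).
Proof.
rcb_types hB; lcb_types hC; do !split; rewrite /= ?/mulZ ?/DeltaZ; solve [typ | diagram rules].
Qed.

Lemma onto_ltimes : bialgebra_morphism Z (ltimes H B) (eps C ⊗ idm (H ⊠ B)).
Proof.
rcb_types hB; lcb_types hC; do !split; rewrite /= ?/mulZ ?/DeltaZ; solve [typ | diagram rules].
Qed.

Lemma tens_into : algebra_morphism (tens_algcoalg C B) Z (idm C ⊗ eta H ⊗ idm B).
Proof.
rcb_types hB; lcb_types hC; split; rewrite /= ?/mulZ; solve [typ | diagram rules].
Qed.

Lemma onto_tens : coalgebra_morphism Z (tens_algcoalg C B) (idm C ⊗ eps H ⊗ idm B).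
Proof.
rcb_types hB; lcb_types hC; split; rewrite /= ?/DeltaZ; solve [typ | diagram rules].
Qed.

Lemma tens_algebra : algebra (tens_algcoalg C B).
Proof.
rcb_types hB; lcb_types hC; split; rewrite /=; solve [typ | diagram rules].
Qed.

Lemma tens_coalgebra : coalgebra (tens_algcoalg C B).
Proof.
rcb_types hB; lcb_types hC; split; rewrite /=; solve [typ | diagram rules].
Qed.
End Morphisms.

Theorem proposition3p3 (K : sbmc) (splitK : idempotents_split K)
  (H : bialg_data K) (S : mor K) (hopfH : hopf_algebra H S) (isoS : iso S)
  (B : xbialg_data K) (bialgB : right_crossed_bialgebra H B)
  (C : xbialg_data K) (bialgC : left_crossed_bialgebra H C)
  (T : rel_tensor H) :
  let X := hb_ltimes T B in
  let Y := hb_rtimes T C in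
  let Z := hb_forget T (hb_tensor T Y X) in
  (* the identification of the tensor product over H of Y and X with C ⊠ H ⊠ B *)
  [/\ hcar (ht T Y X) = C ⊠ H ⊠ B, lam T Y X = idm C ⊗ mul H ⊗ idm B
    & rho T Y X = idm C ⊗ Delta H ⊗ idm B] ->
  (Psi C B ∘ Psi B C
     = (act B ⊗ act C) ∘ (idm B ⊗ Psi H H ⊗ idm C) ∘ (coact B ⊗ coact C)
   <-> hbraid T Y X ∘ hbraid T X Y = idm (ht T X Y))
  /\
  (Psi C B ∘ Psi B C
     = (act B ⊗ act C) ∘ (idm B ⊗ Psi H H ⊗ idm C) ∘ (coact B ⊗ coact C) ->
   [/\ [/\ bialgebra Z, bialgebra (rtimes H C) & bialgebra (ltimes H B)],
       [/\ mul Z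
           = (mul C ⊗ idm H ⊗ mul B)
             ∘ (idm C ⊗ act C ⊗ mul H ⊗ act B ⊗ idm B)
             ∘ (idm C ⊗ idm H ⊗ Psi H C ⊗ Psi B H ⊗ idm H ⊗ idm B)
             ∘ (idm C ⊗ Delta H ⊗ Psi B C ⊗ Delta H ⊗ idm B),
           Delta Z
           = (idm C ⊗ mul H ⊗ Psi C B ⊗ mul H ⊗ idm B)
             ∘ (idm C ⊗ idm H ⊗ Psi C H ⊗ Psi H B ⊗ idm H ⊗ idm B)
             ∘ (idm C ⊗ coact C ⊗ Delta H ⊗ coact B ⊗ idm B)
             ∘ (Delta C ⊗ idm H ⊗ Delta B),
           eta Z = eta C ⊗ eta H ⊗ eta B
         & eps Z = eps C ⊗ eps H ⊗ eps B],
       (bialgebra_morphism (rtimes H C) Z (idm (C ⊠ H) ⊗ eta B)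
          /\ mono (idm (C ⊠ H) ⊗ eta B))
       /\ (bialgebra_morphism (ltimes H B) Z (eta C ⊗ idm (H ⊠ B))
          /\ mono (eta C ⊗ idm (H ⊠ B))),
       (bialgebra_morphism Z (rtimes H C) (idm (C ⊠ H) ⊗ eps B)
          /\ epi (idm (C ⊠ H) ⊗ eps B))
       /\ (bialgebra_morphism Z (ltimes H B) (eps C ⊗ idm (H ⊠ B))
          /\ epi (eps C ⊗ idm (H ⊠ B)))
     & [/\ algebra (tens_algcoalg C B),
           algebra_morphism (tens_algcoalg C B) Z (idm C ⊗ eta H ⊗ idm B)
             /\ mono (idm C ⊗ eta H ⊗ idm B),
           coalgebra (tens_algcoalg C B)
         & coalgebra_morphism Z (tens_algcoalg C B) (idm C ⊗ eps H ⊗ idm B)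
             /\ epi (idm C ⊗ eps H ⊗ idm B)]]).
Proof.
move=> X Y Z ident; split.
  by have E := @hbraid_involutive _ _ _ hopfH _ _ bialgB bialgC T ident.
move=> inv; have hH : bialgebra H by case: hopfH.
move: (mul_typ hH) (eta_typ hH) (Delta_typ hH) (eps_typ hH) => ? ? ? ?.
rcb_types bialgB; lcb_types bialgC.
(* The carriers are only propositionally equal; once [carE] and the four formulas are rewritten
   backwards, the two records coincide field by field. *)
have -> : Z = cross_product H B C.
  have [carE _ _] := ident.
  have mZ := @mulZ_formula _ _ _ hopfH _ _ bialgB bialgC T ident.
  have DZ := @DeltaZ_formula _ _ _ hopfH _ _ bialgB bialgC T ident.
  have eZ := @etaZ_formula _ _ _ hopfH _ _ bialgB bialgC T ident.
  have pZ := @epsZ_formula _ _ _ hopfH _ _ bialgB bialgC T ident.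
  rewrite /cross_product /mulZ /DeltaZ -mZ -DZ -eZ -pZ -carE.
  by [].
have hZ := cross_product_bialgebra hH bialgB bialgC inv.
have i1 := rtimes_into hH bialgB bialgC; have i2 := ltimes_into hH bialgB bialgC.
have p1 := onto_rtimes hH bialgB bialgC; have p2 := onto_ltimes hH bialgB bialgC.
have pi1 : (idm (C ⊠ H) ⊗ eps B) ∘ (idm (C ⊠ H) ⊗ eta B) = idm (C ⊠ H).
  by diagram (eps_eta (rcb_bialg bialgB)).
have pi2 : (eps C ⊗ idm (H ⊠ B)) ∘ (eta C ⊗ idm (H ⊠ B)) = idm (H ⊠ B).
  by diagram (eps_eta (lcb_bialg bialgC)).
have pi3 : (idm C ⊗ eps H ⊗ idm B) ∘ (idm C ⊗ eta H ⊗ idm B) = idm (C ⊠ B).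
  by diagram (eps_eta hH).
split.
- split=> //.
    by apply: (@bialgebra_retract _ (rtimes H C) _ _ _ hZ pi1 i1 p1); rewrite /=; typ.
  by apply: (@bialgebra_retract _ (ltimes H B) _ _ _ hZ pi2 i2 p2); rewrite /=; typ.
- by split.
- by split; split=> //; [apply: (split_mono (b := C ⊠ H ⊠ B)) pi1
    | apply: (split_mono (b := C ⊠ H ⊠ B)) pi2]; typ.
- by split; split=> //; [apply: (split_epi (a := C ⊠ H ⊠ B)) pi1
    | apply: (split_epi (a := C ⊠ H ⊠ B)) pi2]; typ.
have t3 := tens_into hH bialgB bialgC; have q3 := onto_tens hH bialgB bialgC.
split; [exact: (tens_algebra hH bialgB bialgC) | split=> //
  | exact: (tens_coalgebra hH bialgB bialgC) | split=> //].
  by apply: (split_mono (b := C ⊠ H ⊠ B)) pi3; typ.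
by apply: (split_epi (a := C ⊠ H ⊠ B)) pi3; typ.
Qed.
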